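(* Let $\mathcal G$ be the IIC on $\mathbb B$ and $Y$ the continuous-time simple random walk on $\mathcal G$ (see context). For $n\ge1$ define $\widetilde Z^{(n)}_t=n^{-1/3}d(0,Y_{nt})$, $t\ge0$. Then for $\mathbb P$-almost every $\omega$, the family of processes $(\widetilde Z^{(n)})_{n\ge1}$ is not tight with respect to $P^0_\omega$.
   Context: Let $n_0\ge2$ and let $\mathbb B$ be the rooted tree with root $0$ in which every vertex has exactly $n_0$ children; $d$ is the graph distance, $\mathbb B_k$ the vertices at distance $k$ from $0$, $\mathbb B_{\le k}=\bigcup_{i\le k}\mathbb B_i$. Let $\mathcal C(0)$ be the open cluster of $0$ for independent bond percolation on $\mathbb B$ with edge probability $1/n_0$ (law $P$). The IIC $\mathcal G$ is the random infinite subtree of $\mathbb B$ containing $0$ with law $\mathbb P$ determined by $\mathbb P(\mathcal G\cap\mathbb B_{\le k}=A)=|A\cap\mathbb B_k|\,P(\mathcal C(0)\cap\mathbb B_{\le k}=A)$ for all $k$, $A\subset\mathbb B_{\le k}$. Given $\mathcal G=\mathcal G(\omega)$, $Y$ is the continuous-time simple random walk on $\mathcal G$ (exponential mean-1 holding times, jumps to a uniform neighbour in $\mathcal G$), and $P^0_\omega$ is its law started at $0$. *)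

(* Defs.v *)
From HB Require Import structures.
From mathcomp Require Import all_boot all_order all_algebra.
From mathcomp Require Import all_classical all_reals all_analysis.
Unset Printing Implicit Defensive.
Import Order.TTheory GRing.Theory Num.Theory.
Import numFieldNormedType.Exports.
Local Open Scope classical_set_scope.
Local Open Scope ring_scope.

(* The n0-ary rooted tree B.  A vertex is a word over 'I_n0; the root   *)
(* 0 is the empty word, the children of u are the words i :: u, so the *)
(* parent of a non-root vertex u is behead u and depth = size.          *)
Definition vtx (n0 : nat) := seq 'I_n0.
Definition root {n0 : nat} : vtx n0 := [::].

Definition tree_nbrs {n0 : nat} (x : vtx n0) : seq (vtx n0) :=
  (if x is _ :: p then [:: p] else [::]) ++ [seq i :: x | i <- enum 'I_n0].
Definition tree_adj {n0 : nat} (x y : vtx n0) : bool := y \in tree_nbrs x.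

Definition dist0 {n0 : nat} (v : vtx n0) : nat := size v.

Fixpoint level (n0 : nat) (k : nat) : seq (vtx n0) :=
  if k is k'.+1 then [seq i :: u | i <- enum 'I_n0, u <- level n0 k']
  else [:: [::]].
Definition Ble (n0 k : nat) : set (vtx n0) := [set v | (size v <= k)%N].

(* edges of B_{<=k}, each labelled by its lower endpoint (the child) *)
Definition edges (n0 k : nat) : seq (vtx n0) :=
  flatten [seq level n0 j | j <- iota 1 k].

(* Bond percolation.  eta v = true means the edge {behead v, v} is open. *)
Definition open_adj {n0 : nat} (eta : vtx n0 -> bool) (x y : vtx n0) : bool :=
  tree_adj x y && eta (if (size x < size y)%N then y else x).

Definition cluster {n0 : nat} (eta : vtx n0 -> bool) : set (vtx n0) :=
  [set v | exists2 p : seq (vtx n0), path (open_adj eta) root p & last root p = v].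

Definition conf_of (n0 k : nat) (S : {set 'I_(size (edges n0 k))}) : vtx n0 -> bool :=
  fun v => [exists i in S, nth root (edges n0 k) i == v].

Section Perc.
Variable R : realType.

(* P(C(0) \cap B_{<=k} = A) for bond percolation with parameter 1/n0:   *)
(* the event only depends on the finitely many edges of B_{<=k}, over   *)
(* whose states we sum with the product Bernoulli(1/n0) weights.        *)
Definition perc_prob (n0 k : nat) (A : set (vtx n0)) : R :=
  let p : R := (n0%:R)^-1 in
  \sum_(S : {set 'I_(size (edges n0 k))})
     p ^+ #|S| * (1 - p) ^+ (size (edges n0 k) - #|S|)
     * (asbool (cluster (@conf_of n0 k S) `&` Ble n0 k = A))%:R.

Definition IIC_law (n0 : nat) d (Omega : measurableType d)
    (P : probability Omega R) (G : Omega -> set (vtx n0)) : Prop :=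
  forall (k : nat) (A : set (vtx n0)),
    measurable [set w | G w `&` Ble n0 k = A] /\
    P [set w | G w `&` Ble n0 k = A] =
      ((count (fun v => asbool (A v)) (level n0 k))%:R * perc_prob n0 k A)%:E.

Definition deg {n0 : nat} (G : set (vtx n0)) (x : vtx n0) : nat :=
  count (fun y => asbool (G y)) (tree_nbrs x).
Definition trans {n0 : nat} (G : set (vtx n0)) (x y : vtx n0) : R :=
  if asbool (G y) && tree_adj x y then ((deg G x)%:R)^-1 else 0.

(* (X, E) realises the continuous-time SRW on G started at 0: X is the  *)
(* jump chain (discrete SRW on G from 0), E i the holding time in X i;  *)
(* holding times are i.i.d. Exp(1), independent of X.                   *)
Definition walk_law {n0 : nat} (G : set (vtx n0)) d' (Omega' : measurableType d')
    (Q : probability Omega' R) (X : nat -> Omega' -> vtx n0)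
    (E : nat -> Omega' -> R) : Prop :=
  [/\ (forall i v, measurable [set w | X i w = v]),
      (forall i, measurable_fun setT (E i)) &
      forall (m : nat) (x : nat -> vtx n0) (s : nat -> R), (forall i, 0 <= s i) ->
        Q [set w | forall i, (i <= m)%N -> X i w = x i /\ s i < E i w] =
        ((x 0%N == root)%:R * \prod_(i < m) trans G (x i) (x i.+1)
           * \prod_(i < m.+1) expR (- s i))%:E].

Definition jtime {Omega' : Type} (E : nat -> Omega' -> R) (k : nat) (w : Omega') : R :=
  \sum_(i < k) E i w.
Definition Ywalk {n0 : nat} {Omega' : Type} (X : nat -> Omega' -> vtx n0)
    (E : nat -> Omega' -> R) (w : Omega') (t : R) : vtx n0 :=
  X (xget 0%N [set k | jtime E k w <= t < jtime E k.+1 w]) w.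

Definition Ztilde {n0 : nat} {Omega' : Type} (X : nat -> Omega' -> vtx n0)
    (E : nat -> Omega' -> R) (n : nat) (w : Omega') : R -> R :=
  fun t => ((n%:R `^ (3^-1 : R))^-1 * (dist0 (Ywalk X E w (n%:R * t)))%:R).

(* Skorokhod space D([0,oo), R) with the J1 topology.  Paths are         *)
(* functions R -> R; only their restriction to [0,oo) matters.           *)
Definition cadlag (f : R -> R) : Prop :=
  (forall t, 0 <= t -> f x @[x --> t^'+] --> f t) /\
  (forall t, 0 < t -> cvg (f x @[x --> t^'-])).

Definition timechange (l : R -> R) : Prop :=
  [/\ forall t, 0 <= t -> 0 <= l t,
      forall s t, 0 <= s -> s < t -> l s < l t &
      forall y, 0 <= y -> exists2 t, 0 <= t & l t = y].

(* J1 convergence x_n -> y (Ethier-Kurtz, Prop. 3.5.3 (b)) *)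
Definition J1_cvg (x : nat -> R -> R) (y : R -> R) : Prop :=
  exists lam : nat -> R -> R, (forall n, timechange (lam n)) /\
    forall T, 0 < T -> forall eps, 0 < eps -> exists N : nat, forall n, (N <= n)%N ->
      forall t, 0 <= t <= T -> `|lam n t - t| < eps /\ `|x n t - y (lam n t)| < eps.

(* compact subsets of the (metrizable) space D: sequentially compact *)
Definition D_compact (K : set (R -> R)) : Prop :=
  K `<=` cadlag /\
  forall x : nat -> R -> R, (forall n, K (x n)) ->
    exists (phi : nat -> nat) (y : R -> R),
      [/\ forall n m, (n < m)%N -> (phi n < phi m)%N, K y & J1_cvg (x \o phi) y].

(* tightness of the laws of the D-valued processes (Z n)_{n >= 1} under Q *)
(* (probabilities of {Z n \in K} read as inner measures)               *)
Definition tight_family d' (Omega' : measurableType d') (Q : probability Omega' R)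
    (Z : nat -> Omega' -> R -> R) : Prop :=
  forall eps : R, 0 < eps -> exists K, D_compact K /\
    forall n, (0 < n)%N -> exists M, [/\ measurable M, M `<=` [set w | K (Z n w)] &
                                       ((1 - eps)%:E <= Q M)%E].
End Perc.

Arguments IIC_law {R n0 d Omega}.
Arguments walk_law {R n0} G {d' Omega'}.
Arguments tight_family {R d' Omega'}.
Arguments Ztilde {R n0 Omega'}.

(* Main.v *)
(* The IIC is almost surely thin at some scales: for every [lam] there is [r] such
   that the ball of radius [r] has at most [r^2 / lam] vertices. Indeed, a
   Laplace transform estimate for the size-biased branching process shows that,
   whatever the first [k] generations are, this happens at a suitable scale
   [r > k] with probability at least [c(lam) > 0], and scales can be iterated.
   At a thin scale, the Green function of the walk killed on leaving the ball is
   at most [r] times the degree, so that the mean exit time is of order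
   [r^3 / lam]; with [n] of that order, [n^(-1/3) d(0, Y)] exceeds a multiple of
   [lam^(1/3)] before time [n] with probability at least [3/4]. Compact subsets
   of the Skorokhod space are uniformly bounded on [[0, 1]], which contradicts
   tightness as [lam] is arbitrary. *)
Require Import Defs.
From HB Require Import structures.
From mathcomp Require Import all_boot all_order all_algebra.
From mathcomp Require Import all_classical all_reals all_analysis.
From mathcomp Require Import measurable_realfun ring lra zify.
Import Order.TTheory GRing.Theory Num.Theory.
Import numFieldNormedType.Exports.
Local Open Scope classical_set_scope.
Local Open Scope ring_scope.

Set Implicit Arguments.
Unset Strict Implicit.
Unset Printing Implicit Defensive.

(** * Bernoulli configurations *)

(** Thinness comes from a linear cost against a quadratic gain. With e = b / r, keeping the Laplace
    weight alive up to generation r costs a factor exp(-O(b)), while a ball of more than r^2 / lam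
    vertices is discounted by exp(-b^2 / (n0^2 lam)); a large multiple of n0^2 lam for b separates
    the two. The first k generations do not matter once r is large compared with their maximal size.
    Every probability about the IIC is a size-biased percolation expectation over finitely many
    generations, and these are what the estimates bound. The law of the walk is given only through
    joint probabilities of positions and of holding times above thresholds. The exit time is
    therefore controlled by Markov's inequality for a finite sum of indicators of such events. The
    walk uses two deterministic properties of the tree, being an infinite tree and having thin
    scales, so one null set of environments serves all realisations of the walk. *)

Fixpoint bern {R : realType} {T : eqType} (p : R) (l : seq T)
    (g : (T -> bool) -> R) : R :=
  if l is v :: l' then
    p * bern p l' (fun eta => g (fun u => (v == u) || eta u))
    + (1 - p) * bern p l' g
  else g (fun=> false).

Section Bernoulli.
Variables (R : realType) (T : eqType) (p : R).
Hypothesis p01 : 0 <= p <= 1.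
Implicit Types (l : seq T) (eta : T -> bool) (g : (T -> bool) -> R).

Lemma eq_bern l g g' :
  (forall eta, (forall u, eta u -> u \in l) -> g eta = g' eta) ->
  bern p l g = bern p l g'.
Proof.
elim: l g g' => [|v l IH] g g' gg' /=; first by rewrite gg'.
congr (_ * _ + _ * _); apply: IH => eta eta_l; apply: gg' => u.
  by rewrite inE => /orP[/eqP ->|/eta_l ->]; rewrite ?eqxx ?orbT.
by rewrite inE => /eta_l ->; rewrite orbT.
Qed.

Lemma le_bern l g g' :
  (forall eta, (forall u, eta u -> u \in l) -> g eta <= g' eta) ->
  bern p l g <= bern p l g'.
Proof.
have /andP[p0 p1] := p01.
elim: l g g' => [|v l IH] g g' gg' /=; first by rewrite gg'.
apply: lerD; (apply: ler_wpM2l; first by rewrite ?subr_ge0);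
  apply: IH => eta eta_l; apply: gg' => u.
  by rewrite inE => /orP[/eqP ->|/eta_l ->]; rewrite ?eqxx ?orbT.
by rewrite inE => /eta_l ->; rewrite orbT.
Qed.

Lemma bernZ l g c : bern p l (fun eta => c * g eta) = c * bern p l g.
Proof. by elim: l g => //= v l IH g; rewrite !IH; ring. Qed.

Lemma bernD l g g' :
  bern p l (fun eta => g eta + g' eta) = bern p l g + bern p l g'.
Proof. by elim: l g g' => //= v l IH g g'; rewrite !IH; ring. Qed.

(** Splitting the edge list amounts to conditioning on the state of the first edges; this is why the
    expectation is defined by recursion on a list. *)
Lemma bern_cat l1 l2 g :
  bern p (l1 ++ l2) g =
  bern p l1 (fun eta1 => bern p l2 (fun eta2 => g (fun u => eta1 u || eta2 u))).
Proof.
elim: l1 g => [|v l1 IH] g //=; rewrite !IH; congr (_ * _ + _).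
apply: eq_bern => eta1 _; apply: eq_bern => eta2 _; congr g.
by apply/funext => u; rewrite orbA.
Qed.

Definition conf_seq (x0 : T) l (S : {set 'I_(size l)}) : T -> bool :=
  fun v => [exists i in S, nth x0 l i == v].
Arguments conf_seq : clear implicits.

(** Bridge to the sum over subsets in [perc_prob]: a subset of the indices of [v :: l] is a bit for
    [ord0] together with a subset of the indices of [l], shifted by [lift]. *)
Lemma sum_set_bern (x0 : T) l g :
  \sum_(S : {set 'I_(size l)})
     p ^+ #|S| * (1 - p) ^+ (size l - #|S|) * g (conf_seq x0 l S) = bern p l g.
Proof.
elim: l g => [|v l IH] g /=.
  rewrite (bigD1 finset.set0) //= big1 ?addr0 ?cards0 ?expr0 ?mul1r.
    congr g; apply/funext => u; apply/negbTE/existsP => -[[]] //.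
  move=> S /negP[]; apply/eqP/setP => -[] //.
pose up (bS : bool * {set 'I_(size l)}) : {set 'I_(size l).+1} :=
  [set i | if unlift ord0 i is Some j then j \in bS.2 else bS.1]%SET.
pose dn (S : {set 'I_(size l).+1}) : bool * {set 'I_(size l)} :=
  (ord0 \in S, [set j | lift ord0 j \in S]%SET).
have upK : cancel up dn.
  case=> b S; rewrite /dn /up /= inE unlift_none; congr pair.
  by apply/setP => j; rewrite !inE liftK.
have dnK : cancel dn up.
  move=> S; apply/setP => i; rewrite /up /dn inE.
  by case: unliftP => [j|] -> /=; rewrite ?inE.
have card_up b S : #|up (b, S)| = (b + #|S|)%N.
  rewrite (cardsD1 ord0) inE unlift_none /=; congr addn.
  rewrite -(card_imset S (@lift_inj _ ord0)); apply: eq_card => i.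
  rewrite !inE; case: unliftP => [j ->|->] /=.
    by rewrite (mem_imset _ _ (@lift_inj _ ord0)).
  by apply/esym/negbTE/imsetP => -[j _] /eqP; rewrite eq_liftF.
have conf_up b S : conf_seq x0 (v :: l) (up (b, S)) =
    (fun u => (b && (v == u)) || conf_seq x0 l S u).
  apply/funext => u; rewrite /conf_seq; apply/existsP/idP.
    move=> [i] /andP[]; rewrite inE; case: unliftP => [j ->|->] /=.
      move=> jS E; apply/orP; right; apply/existsP; exists j.
      by rewrite jS.
    by move=> -> ->.
  move=> /orP[/andP[b1 vu]|/existsP[j /andP[jS E]]].
    by exists ord0; rewrite inE unlift_none b1.
  by exists (lift ord0 j); rewrite inE liftK jS.
rewrite (reindex up); last by exists dn => ? _; [exact: upK|exact: dnK].
rewrite -(pair_bigA _ (fun b S => p ^+ #|up (b, S)| *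
  (1 - p) ^+ (size (v :: l) - #|up (b, S)|) * g (conf_seq x0 (v :: l) (up (b, S))))) /=.
rewrite (big_bool) /= -!IH !mulr_sumr.
congr (_ + _); apply: eq_bigr => S _; rewrite card_up conf_up /=.
  by rewrite subSS add1n exprS -!mulrA.
rewrite add0n subSn; last by rewrite -[X in (_ <= X)%N]card_ord max_card.
by rewrite exprS; ring.
Qed.

(* Only the inequality is needed: it replaces the exponent [N.-1] of the exact
   formula by [N]. *)
Lemma bern_count_ge (c : pred T) l (s : R) (a : nat) :
  uniq l -> 0 <= s <= 1 ->
  s ^+ a * (1 - p + p * s) ^+ count c l * (a%:R + (count c l)%:R * p * s) <=
  bern p l (fun eta => let X := (a + count (fun v => c v && eta v) l)%N in
                       X%:R * s ^+ X).
Proof.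
have /andP[p0 p1] := p01.
move=> + /andP[s0 s1]; elim: l a => [|v l IH] a /=.
  by rewrite expr0 addn0 mulr1 mul0r mul0r addr0 mulrC.
move=> /andP[vl ul].
have E1 : bern p l (fun eta => let X := (a + (c v && ((v == v) || eta v) +
      count (fun v0 => c v0 && ((v == v0) || eta v0)) l))%N in X%:R * s ^+ X) =
    bern p l (fun eta => let X := ((a + c v) + count (fun v => c v && eta v) l)%N
                         in X%:R * s ^+ X).
  apply: eq_bern => eta eta_l /=; rewrite eqxx andbT addnA.
  suff -> : count (fun v0 => c v0 && ((v == v0) || eta v0)) l =
            count (fun v0 => c v0 && eta v0) l by [].
  by apply: eq_in_count => u ul' /=; case: eqP => // vu; rewrite vu ul' in vl.
have E2 : bern p l (fun eta => let X := (a + (c v && eta v +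
      count (fun v0 => c v0 && eta v0) l))%N in X%:R * s ^+ X) =
    bern p l (fun eta => let X := (a + count (fun v => c v && eta v) l)%N
                         in X%:R * s ^+ X).
  apply: eq_bern => eta eta_l /=.
  suff -> : eta v = false by rewrite andbF.
  by apply/negbTE/negP => /eta_l; rewrite (negbTE vl).
rewrite /= in E1 E2 *; rewrite E1 E2 => {E1 E2}.
have H1 := IH (a + c v)%N ul; have H2 := IH a ul.
apply: le_trans (lerD (ler_wpM2l p0 H1) (ler_wpM2l _ H2)); last by rewrite subr_ge0.
set N := count c l; set q := 1 - p + p * s.
have q0 : 0 <= q by rewrite /q; nra.
have q1 : q <= 1 by rewrite /q; nra.
case: (c v) => /=; last first.
  rewrite addn0 add0n -subr_ge0 le_eqVlt; apply/orP; left; apply/eqP; ring.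
rewrite addn1 add1n !exprS -(natr1 a) -(natr1 N).
have qN : 0 <= s ^+ a * q ^+ N by rewrite mulr_ge0 // exprn_ge0.
rewrite -subr_ge0.
(* The average of the two inductive bounds exceeds the claimed one by a multiple of 1 - q, where q
   <= 1 is the factor of one edge. *)
have -> : p * (s * s ^+ a * q ^+ N * (a%:R + 1 + N%:R * p * s)) +
  (1 - p) * (s ^+ a * q ^+ N * (a%:R + N%:R * p * s)) -
  s ^+ a * (q * q ^+ N) * (a%:R + (N%:R + 1) * p * s) =
  s ^+ a * q ^+ N * (p * s * (1 - q)) by rewrite /q; ring.
by rewrite mulr_ge0 // !mulr_ge0 // subr_ge0.
Qed.

Lemma bern_count (c : pred T) l (a : R) : uniq l ->
  bern p l (fun eta => a + (count (fun v => c v && eta v) l)%:R) =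
  a + (count c l)%:R * p.
Proof.
elim: l a => [|v l IH] a /=; first by rewrite mul0r.
move=> /andP[vl ul].
have -> : bern p l (fun eta => a + (c v && ((v == v) || eta v) +
      count (fun v0 => c v0 && ((v == v0) || eta v0)) l)%:R) =
    bern p l (fun eta => (a + (c v)%:R) + (count (fun v => c v && eta v) l)%:R).
  apply: eq_bern => eta eta_l /=; rewrite eqxx andbT natrD addrA.
  congr (_ + _%:R).
  by apply: eq_in_count => u ul' /=; case: eqP => // vu; rewrite vu ul' in vl.
have -> : bern p l (fun eta => a + (c v && eta v +
      count (fun v0 => c v0 && eta v0) l)%:R) =
    bern p l (fun eta => a + (count (fun v => c v && eta v) l)%:R).
  apply: eq_bern => eta eta_l /=.
  suff -> : eta v = false by rewrite andbF.
  by apply/negbTE/negP => /eta_l; rewrite (negbTE vl).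
by rewrite !IH // natrD; ring.
Qed.

End Bernoulli.

(** * Percolation on the tree *)

Section Tree.
Variable n0 : nat.
Implicit Types (u v : vtx n0) (k : nat) (eta : vtx n0 -> bool) (A : pred (vtx n0)).

Lemma mem_level k v : (v \in level n0 k) = (size v == k).
Proof.
elim: k v => [|k IH] v /=; first by rewrite inE size_eq0.
apply/allpairsP/idP => [[[i u] /= [_ + ->]]|]; first by rewrite IH.
case: v => // i u; rewrite eqSS -IH => uk; exists (i, u).
by rewrite mem_enum.
Qed.

Lemma level_uniq k : uniq (level n0 k).
Proof.
elim: k => //= k IH; apply: allpairs_uniq => //; first exact: enum_uniq.
by move=> [i u] [j v] _ _ /= [-> ->].
Qed.

Lemma count_level_behead (c : pred (vtx n0)) k :
  count (fun v => c (behead v)) (level n0 k.+1) = (n0 * count c (level n0 k))%N.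
Proof.
rewrite /= count_flatten -map_comp.
rewrite (eq_map (g := fun=> count c (level n0 k))); last first.
  by move=> i /=; rewrite count_map; apply: eq_count.
rewrite -[X in (X * _)%N]card_ord cardE.
by elim: (enum _) => //= i s ->; rewrite mulSn.
Qed.

Definition lvl A k : nat := count A (level n0 k).
(** Generation [k] is excluded: this is the set that the walk leaves on reaching depth [k]. *)
Definition ballcard A k : nat := \sum_(j < k) lvl A j.

Definition balllist k : seq (vtx n0) := flatten [seq level n0 j | j <- iota 0 k].

Lemma mem_balllist k v : (v \in balllist k) = (size v < k)%N.
Proof.
apply/flattenP/idP => [[_ /mapP[j +  ->]]|vk].
  by rewrite mem_iota mem_level add0n => /andP[_ jk] /eqP ->.
exists (level n0 (size v)); last by rewrite mem_level.
by apply/mapP; exists (size v); rewrite // mem_iota add0n.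
Qed.

Lemma balllistS k : balllist k.+1 = balllist k ++ level n0 k.
Proof. by rewrite /balllist -addn1 iotaD map_cat flatten_cat /= cats0. Qed.

Lemma balllist_uniq k : uniq (balllist k).
Proof.
elim: k => // k IH; rewrite balllistS cat_uniq IH level_uniq andbT /=.
apply/hasPn => v; rewrite mem_level mem_balllist => /eqP ->.
by rewrite ltnn.
Qed.

Lemma count_balllist A k : count A (balllist k) = ballcard A k.
Proof.
elim: k => [|k IH]; first by rewrite /ballcard big_ord0.
by rewrite balllistS count_cat IH /ballcard big_ord_recr.
Qed.

Lemma eq_lvl A A' k : (forall v, size v = k -> A v = A' v) -> lvl A k = lvl A' k.
Proof. by move=> AA'; apply: eq_in_count => v; rewrite mem_level => /eqP /AA'. Qed.

Lemma eq_ballcard A A' k :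
  (forall v, (size v < k)%N -> A v = A' v) -> ballcard A k = ballcard A' k.
Proof.
move=> AA'; apply: eq_bigr => j _; apply: eq_lvl => v vj.
by apply: AA'; rewrite vj.
Qed.

(** Boolean form of the cluster: in a tree, being joined to the root means that the whole ancestral
    line is open. *)
Fixpoint conn eta v : bool := if v is i :: u then eta v && conn eta u else true.

Lemma eq_conn eta eta' v :
  (forall u, (size u <= size v)%N -> eta u = eta' u) -> conn eta v = conn eta' v.
Proof.
elim: v => //= i v IH e; rewrite e // IH // => u uv; apply: e.
exact: leq_trans uv _.
Qed.

Lemma tree_adj_child i u : tree_adj u (i :: u).
Proof.
by rewrite /tree_adj /tree_nbrs mem_cat orbC map_f // mem_enum.
Qed.

Lemma tree_adjP u v :
  reflect ((exists i, v = i :: u) \/ (exists i, u = i :: v)) (tree_adj u v).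
Proof.
apply: (iffP idP) => [|[[i ->]|[i ->]]]; last 2 first.
- exact: tree_adj_child.
- by rewrite /tree_adj /tree_nbrs mem_cat inE eqxx.
rewrite /tree_adj /tree_nbrs mem_cat => /orP[|/mapP[i _ ->]]; last by left; exists i.
by case: u => // i u; rewrite inE => /eqP ->; right; exists i.
Qed.

(** An open path may backtrack, but along it each step away from the root adds an open edge to the
    ancestral line and each step back removes one. *)
Lemma cluster_conn eta v : Defs.cluster eta v <-> conn eta v.
Proof.
split=> [[p pp <-]|].
  suff: forall x, conn eta x -> path (open_adj eta) x p -> conn eta (last x p).
    exact.
  elim: p {pp} => //= y p IH x cx /andP[/andP[/tree_adjP xy oy] pp].
  apply: IH pp.
  case: xy => -[i e]; rewrite e in oy cx *.
    by rewrite /= cx andbT; rewrite /= ltnSn in oy.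
  by case/andP: cx.
elim: v => [_|i u IH /= /andP[ei /IH[p pp pu]]]; first by exists [::].
exists (rcons p (i :: u)); last by rewrite last_rcons.
by rewrite rcons_path pp pu /open_adj tree_adj_child /= ltnSn.
Qed.

End Tree.

Arguments balllist : simpl never.

(** * Gluing configurations generation by generation *)

Definition edges_between (n0 k m : nat) : seq (vtx n0) :=
  flatten [seq level n0 j | j <- iota k.+1 m].

Section Configurations.
Variable n0 : nat.
Implicit Types (eta : vtx n0 -> bool).

Definition config_or eta eta' : vtx n0 -> bool := fun u => eta u || eta' u.

Lemma config_orA eta1 eta2 eta3 :
  config_or (config_or eta1 eta2) eta3 = config_or eta1 (config_or eta2 eta3).
Proof. by apply/funext => u; rewrite /config_or orbA. Qed.

Lemma edges_split k m : edges n0 (k + m) = edges n0 k ++ edges_between n0 k m.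
Proof. by rewrite /edges /edges_between iotaD map_cat flatten_cat add1n. Qed.

Lemma mem_edges_between k m v : (v \in edges_between n0 k m) = (k < size v <= k + m)%N.
Proof.
apply/flattenP/idP => [[_ /mapP[j +  ->]]|vk].
  by rewrite mem_iota mem_level => jk /eqP ->; lia.
exists (level n0 (size v)); last by rewrite mem_level.
by apply/mapP; exists (size v); rewrite // mem_iota; lia.
Qed.

Lemma mem_edges k v : (v \in edges n0 k) = (0 < size v <= k)%N.
Proof. exact: (mem_edges_between 0). Qed.

Definition supported k eta := forall u, eta u -> (size u <= k)%N.

Lemma supported_edges k eta : (forall u, eta u -> u \in edges n0 k) -> supported k eta.
Proof. by move=> h u /h; rewrite mem_edges => /andP[]. Qed.

Lemma conn_or_low k eta eta' v : (forall u, eta' u -> (k < size u)%N) ->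
  (size v <= k)%N -> conn (config_or eta eta') v = conn eta v.
Proof.
move=> h vk; apply: eq_conn => u uv; rewrite /config_or.
case e: (eta' u); last by rewrite orbF.
by have := h _ e; lia.
Qed.

Lemma ballcard_or_low k j eta eta' : (forall u, eta' u -> (k < size u)%N) ->
  (j <= k.+1)%N -> ballcard (conn (config_or eta eta')) j = ballcard (conn eta) j.
Proof.
move=> h jk; apply: eq_ballcard => v vj; apply: (@conn_or_low k) => //; lia.
Qed.

(** This is the branching property: a vertex of generation [k.+1] is present when its parent is
    connected and its own fresh edge is open, so the new generation is a count to which [bern_count]
    and [bern_count_ge] apply. *)
Lemma lvl_or_next k eta eta' : supported k eta ->
  (forall u, eta' u -> (k < size u)%N) ->
  lvl (conn (config_or eta eta')) k.+1 =
  count (fun v => conn eta (behead v) && eta' v) (level n0 k.+1).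
Proof.
move=> sk h; apply: eq_in_count => -[|i v]; rewrite mem_level // => /eqP[vk].
rewrite /= (@conn_or_low k) ?vk // andbC; congr andb.
rewrite /config_or; case e: (eta (i :: v)) => //.
by have := sk _ e; rewrite /= vk ltnn.
Qed.

Lemma supported_level k eta : (forall u, eta u -> u \in level n0 k.+1) ->
  forall u, eta u -> (k < size u)%N.
Proof. by move=> h u /h; rewrite mem_level => /eqP ->. Qed.

Lemma supported_or k eta eta' : supported k eta ->
  (forall u, eta' u -> u \in level n0 k.+1) -> supported k.+1 (config_or eta eta').
Proof.
move=> s h u /orP[/s|/h]; first lia.
by rewrite mem_level => /eqP ->.
Qed.

Lemma edges_betweenS k m :
  edges_between n0 k m.+1 = level n0 k.+1 ++ edges_between n0 k.+1 m.
Proof. by []. Qed.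

End Configurations.

(** * Critical growth and the Laplace transform bound *)

Section Growth.
Variables (R : realType) (n0 : nat).
Hypothesis hn0 : (2 <= n0)%N.
Let p : R := n0%:R^-1.
Implicit Types (eta : vtx n0 -> bool).

Lemma offspring_mean1 : n0%:R * p = 1 :> R.
Proof. by rewrite /p mulfV // pnatr_eq0; lia. Qed.

Lemma edge_prob_itv01 : 0 <= p <= 1.
Proof.
rewrite invr_ge0 ler0n /= invf_le1 ?ler1n ?ltr0n; lia.
Qed.

Lemma bern_edges_betweenS k m eta (g : (vtx n0 -> bool) -> R) :
  bern p (edges_between n0 k m.+1) (fun eta' => g (config_or eta eta')) =
  bern p (level n0 k.+1) (fun eta1 => bern p (edges_between n0 k.+1 m)
    (fun eta2 => g (config_or (config_or eta eta1) eta2))).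
Proof.
rewrite edges_betweenS bern_cat; apply: eq_bern => eta1 _; apply: eq_bern => eta2 _.
by rewrite config_orA.
Qed.

(** Criticality, [n0 * p = 1], makes the generation size a martingale; hence size-biasing by it
    yields a probability. *)
Lemma bern_lvl k m eta : supported k eta ->
  bern p (edges_between n0 k m)
    (fun eta' => (lvl (conn (config_or eta eta')) (k + m))%:R) =
  (lvl (conn eta) k)%:R.
Proof.
elim: m k eta => [|m IH] k eta sk.
  rewrite addn0 /=; congr (lvl _ _)%:R; congr conn.
  by apply/funext => u; rewrite /config_or orbF.
rewrite (bern_edges_betweenS _ _ _ (fun e => (lvl (conn e) (k + m.+1))%:R)).
rewrite (eq_bern _ (g' := fun eta1 =>
  0 + (count (fun v => conn eta (behead v) && eta1 v) (level n0 k.+1))%:R)).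
  rewrite bern_count ?level_uniq // add0r count_level_behead natrM mulrAC.
  by rewrite offspring_mean1 mul1r.
move=> eta1 h1; rewrite add0r -(@lvl_or_next _ k) //; last exact: supported_level.
by rewrite -addSnnS IH //; exact: supported_or.
Qed.

(** The term x^2 gained over Bernoulli's inequality reflects the variance of the offspring law and
    pays for the discount per vertex. The case n = 2 is an equality. *)
Lemma binom2_le (x : R) (n : nat) : 0 <= x <= 1 -> (2 <= n)%N ->
  1 - n%:R * x + x ^+ 2 <= (1 - x) ^+ n.
Proof.
move=> /andP[x0 x1]; case: n => [|[|n]] // _; elim: n => [|n IH].
  by rewrite !expr2; lra.
have -> : (1 - x) ^+ n.+3 = (1 - x) * (1 - x) ^+ n.+2 by rewrite exprS.
apply: le_trans (ler_wpM2l _ IH); last lra.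
rewrite -[n.+3%:R]natr1 -subr_ge0.
have -> : (1 - x) * (1 - n.+2%:R * x + x ^+ 2) -
   (1 - (n.+2%:R + 1) * x + x ^+ 2) = x ^+ 2 * (n.+2%:R - x) by ring.
rewrite mulr_ge0 ?sqr_ge0 // subr_ge0 (le_trans x1) //.
by rewrite ler1n.
Qed.

Section Subsolution.
Variable e : R.
Hypothesis e01 : 0 <= e <= 1.
(** In [weight], [s] marks the vertices of the last generation and [r] those of all earlier ones; 1
    - [r] is the gain x^2 of [binom2_le] at x = e p. *)
Let s := 1 - e.
Let r := 1 - (e * p) ^+ 2.

Lemma subsol_le_discount : s <= r.
Proof.
have /andP[e0 e1] := e01; have /andP[p0 p1] := edge_prob_itv01.
rewrite /s /r lerD2l lerN2 expr2.
have epe : e * p <= e by rewrite ler_piMr.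
by apply: le_trans epe; rewrite ler_piMr ?mulr_ge0 // (le_trans _ e1) // ler_piMr.
Qed.

Lemma subsol_itv01 : 0 <= s <= 1.
Proof. by have /andP[? ?] := e01; rewrite /s; apply/andP; split; lra. Qed.

Lemma discount_itv01 : 0 <= r <= 1.
Proof.
have /andP[s0 _] := subsol_itv01; have sr := subsol_le_discount.
have := sqr_ge0 (e * p).
by rewrite /r in sr *; move=> h; apply/andP; split; lra.
Qed.

(* [s] is a subsolution of the fixed point equation [x = r f(x)], where [f] is
   the offspring generating function. *)
Lemma subsolution : s <= r * (1 - p + p * s) ^+ n0.
Proof.
have /andP[e0 e1] := e01; have /andP[p0 p1] := edge_prob_itv01.
have ep0 : 0 <= e * p by rewrite mulr_ge0.
have epe : e * p <= e by rewrite ler_piMr.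
have ep1 : e * p <= 1 by exact: le_trans e1.
have -> : 1 - p + p * s = 1 - e * p by rewrite /s; ring.
have /andP[r0 _] := discount_itv01.
apply: le_trans (ler_wpM2l r0 (@binom2_le _ n0 _ hn0)); last by rewrite ep0.
have -> : n0%:R * (e * p) = e by rewrite mulrCA offspring_mean1 mulr1.
rewrite /r /s; set d := (e * p) ^+ 2.
have d0 : 0 <= d by exact: sqr_ge0.
have de : d <= e.
  by apply: le_trans epe; rewrite /d expr2 -[leRHS]mulr1 ler_wpM2l.
(* The difference of the two sides is (1 - d)(1 - e + d) - (1 - e) = d (e - d). *)
nra.
Qed.

(* Up to the factor [s] per generation, [weight] is a submartingale under
   percolation: this is what makes a thin IIC not too unlikely. *)
Definition weight eta k : R :=
  (lvl (conn eta) k)%:R * s ^+ lvl (conn eta) k * r ^+ ballcard (conn eta) k.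

(** Write z for the size of generation [k] and q = 1 - p + p s. The new generation has n0 z
    potential members, so [bern_count_ge] gives the prefactor n0 z p s = z s and the power q^(n0 z).
    The z vertices that enter the ball add r^z, and r q^n0 >= s by [subsolution]. *)
Lemma bern_weight_step k eta : supported k eta ->
  s * weight eta k <=
  bern p (level n0 k.+1) (fun eta1 => weight (config_or eta eta1) k.+1).
Proof.
move=> sk; have /andP[p0 p1] := edge_prob_itv01.
have /andP[r0 r1] := discount_itv01; have /andP[s0 s1] := subsol_itv01.
rewrite (eq_bern _ (g' := fun eta1 => r ^+ ballcard (conn eta) k.+1 *
  (let X := (0 + count (fun v => conn eta (behead v) && eta1 v) (level n0 k.+1))%N
   in X%:R * s ^+ X))); last first.
  move=> eta1 h1; rewrite /weight /= add0n.
  rewrite (@lvl_or_next _ k) //; last exact: supported_level.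
  rewrite (@ballcard_or_low _ k) //; last exact: supported_level.
  by rewrite mulrC.
rewrite bernZ.
have := @bern_count_ge R (vtx n0) p edge_prob_itv01 (fun v => conn eta (behead v))
  (level n0 k.+1) s 0 (level_uniq _ _) subsol_itv01.
rewrite count_level_behead expr0 mul1r add0r => H.
apply: le_trans (ler_wpM2l _ H); last exact: exprn_ge0.
rewrite /weight; set z := lvl (conn eta) k.
rewrite -/(lvl (conn eta) k) -/z natrM [n0%:R * z%:R * p]mulrAC offspring_mean1 mul1r.
have -> : ballcard (conn eta) k.+1 = (ballcard (conn eta) k + z)%N.
  by rewrite /ballcard big_ord_recr.
rewrite exprD exprM.
have H2 : s ^+ z <= (r * (1 - p + p * s) ^+ n0) ^+ z.
  by apply: lerXn2r subsolution; rewrite nnegrE // (le_trans s0 subsolution).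
rewrite exprMn in H2.
set rb := r ^+ ballcard _ _; have rb0 : 0 <= rb by exact: exprn_ge0.
rewrite [leLHS](_ : _ = (rb * z%:R * s) * s ^+ z); last by ring.
rewrite [leRHS](_ : _ = (rb * z%:R * s) *
  (r ^+ z * ((1 - p + p * s) ^+ n0) ^+ z)); last by ring.
by apply: ler_wpM2l H2; rewrite !mulr_ge0.
Qed.

Lemma bern_weight k m eta : supported k eta ->
  s ^+ m * weight eta k <=
  bern p (edges_between n0 k m) (fun eta' => weight (config_or eta eta') (k + m)).
Proof.
have /andP[s0 s1] := subsol_itv01.
elim: m k eta => [|m IH] k eta sk.
  rewrite addn0 expr0 mul1r /=; set eta' := config_or _ _.
  suff -> : eta' = eta by [].
  by apply/funext => u; rewrite /eta' /config_or orbF.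
rewrite (bern_edges_betweenS _ _ _ (fun e => weight e (k + m.+1))).
rewrite exprSr -mulrA.
apply: (le_trans (ler_wpM2l _ (bern_weight_step sk))); first exact: exprn_ge0.
rewrite -bernZ; apply: le_bern; first exact: edge_prob_itv01.
by move=> eta1 h1; rewrite -addSnnS; apply: IH; exact: supported_or.
Qed.

End Subsolution.

End Growth.

(** * Thin scales *)

(** The scale 0, whose ball is empty, would satisfy the inequality for every [lam]. *)
Definition thin {n0 : nat} (lam r : nat) (A : pred (vtx n0)) : bool :=
  (0 < r)%N && (lam * ballcard A r <= r ^ 2)%N.

Definition nothin {n0 : nat} (lam k : nat) (A : pred (vtx n0)) : bool :=
  all (fun r => ~~ thin lam r A) (iota 0 k.+1).

Section Thin.
Variables (R : realType) (n0 : nat).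
Hypothesis hn0 : (2 <= n0)%N.
Let p : R := n0%:R^-1.
Implicit Types (eta : vtx n0 -> bool).

Lemma expR_le_sub (e : R) : 0 <= e -> e <= 2^-1 -> expR (- (2 * e)) <= 1 - e.
Proof.
move=> e0 e2; rewrite expRN.
have h : 1 + 2 * e <= expR (2 * e) by exact: expR_ge1Dx.
apply: (@le_trans _ _ (1 + 2 * e)^-1).
  by rewrite lef_pV2 // posrE ?expR_gt0 //; lra.
have h1 : 0 < 1 + 2 * e by lra.
rewrite -(ler_pM2r h1) mulVf ?gt_eqF //; nra.
Qed.

Lemma lvl_bound (A : pred (vtx n0)) k : (lvl A k <= size (balllist n0 k.+1))%N.
Proof.
rewrite balllistS size_cat; apply: leq_trans (leq_addl _ _).
exact: count_size.
Qed.

Lemma ballcard_bound (A : pred (vtx n0)) k :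
  (ballcard A k <= size (balllist n0 k.+1))%N.
Proof.
rewrite -count_balllist balllistS size_cat; apply: leq_trans (leq_addr _ _).
exact: count_size.
Qed.

(* Conditionally on the first [k] generations the IIC is thin at some scale with
   probability at least [c], and [c] does not depend on [k]. It comes
   from [E(q^V) - q^x <= P(V < x)] with [x = r^2 / lam], [q = 1 - (e p)^2] and
   [e = b / r]. *)
Lemma bern_thin (lam : nat) : (0 < lam)%N ->
  exists2 c : R, 0 < c <= 1 & forall k, exists m, forall eta, supported k eta ->
    bern p (edges_between n0 k m) (fun eta' =>
      (lvl (conn (config_or eta eta')) (k + m))%:R *
      (~~ thin lam (k + m) (conn (config_or eta eta')))%:R) <=
    (1 - c) * (lvl (conn eta) k)%:R.
Proof.
(* This [b] solves b^2 / (n0^2 lam) = 4 b, so that q^V <= exp(-4 b) as soon as V > r^2 / lam. *)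
move=> lam0; pose bn := (4 * n0 ^ 2 * lam)%N; pose b : R := bn%:R.
have n00 : 0 < n0%:R :> R by rewrite ltr0n; lia.
have bn0 : (0 < bn)%N by rewrite /bn !muln_gt0 lam0; lia.
have b0 : 0 < b by rewrite ltr0n.
exists (expR (- (3 * b)) - expR (- (4 * b))).
  have h1 : expR (- (4 * b)) < expR (- (3 * b)) by rewrite ltr_expR; lra.
  have h2 : expR (- (3 * b)) < 1 by rewrite expR_lt1; lra.
  have h3 := expR_gt0 (- (4 * b)).
  by apply/andP; split; lra.
move=> k; pose D := size (balllist n0 k.+1).
(* The term [2 * bn] gives e <= 1/2. The term [4 * D] gives 2 (m + 2 D) <= 3 r, so (1 - e)^(m + 2 D)
   >= exp(-3 b): the first [k] generations, whose size and ball are at most [D], are absorbed in the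
   constant. *)
exists (4 * D + 2 * bn + 1)%N => eta sk.
set m := (4 * D + 2 * bn + 1)%N; set r := (k + m)%N.
have r0 : 0 < r%:R :> R by rewrite ltr0n /r /m; lia.
pose e : R := b / r%:R.
have e0 : 0 <= e by rewrite divr_ge0 // ltW.
have e2 : e <= 2^-1.
  rewrite /e ler_pdivrMr // mulrC ler_pdivlMr // -natrM ler_nat /r /m; lia.
have e01 : 0 <= e <= 1 by rewrite e0 /=; lra.
have er : e * r%:R = b by rewrite /e divfK // gt_eqF.
clearbody e.
have /andP[s0 s1] := subsol_itv01 e01.
have := @bern_weight R n0 hn0 e e01 k m eta sk; rewrite -/p -/r.
set Z := lvl (conn eta) k; set E3 := expR (- (3 * b)); set E4 := expR (- (4 * b)).
have HL : E3 * Z%:R <= (1 - e) ^+ m * weight e eta k.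
  have Hs : E3 <= (1 - e) ^+ (m + D + D).
    have -> : E3 = expR (- (3 * b)) by [].
    apply: (@le_trans _ _ (expR (- (2 * e)) ^+ (m + D + D))); last first.
      by apply: lerXn2r; rewrite ?nnegrE ?expR_ge0 //; exact: expR_le_sub.
    rewrite -expRM_natl ler_expR.
    have -> : (m + D + D)%:R * - (2 * e) = - (2 * (m + D + D)%:R * e) by ring.
    rewrite lerN2 -er.
    have -> : 3 * (e * r%:R) = 3 * r%:R * e by ring.
    by apply: ler_wpM2r => //; rewrite -!natrM ler_nat /r /m; lia.
  rewrite /weight -/Z.
  apply: (@le_trans _ _ ((1 - e) ^+ (m + D + D) * Z%:R)).
    by apply: ler_wpM2r => //; exact: ler0n.
  rewrite (exprD _ (m + D)) (exprD _ m) -!(mulrA ((1 - e) ^+ m)).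
  apply: ler_wpM2l; first exact: exprn_ge0.
  rewrite -[leLHS]mulrA -(mulrA Z%:R) (mulrC Z%:R) -(mulrA ((1 - e) ^+ Z)).
  apply: ler_pM; rewrite ?exprn_ge0 //.
  - by rewrite mulr_ge0 // ?exprn_ge0.
  - by apply: ler_wiXn2l => //; exact: lvl_bound.
  apply: ler_wpM2r; first exact: ler0n.
  apply: (@le_trans _ _ ((1 - e) ^+ ballcard (conn eta) k)).
    by apply: ler_wiXn2l => //; exact: ballcard_bound.
  have sr := @subsol_le_discount R n0 hn0 e e01.
  by apply: lerXn2r; rewrite ?nnegrE //; exact: le_trans s0 sr.
move=> /(le_trans HL) {HL} HL.
(* Pointwise, the weight is at most z at a thin scale and at most z exp(-4 b) otherwise. Taking
   expectations with [bern_lvl] and comparing with [HL] isolates the non-thin part. *)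
have HU : bern p (edges_between n0 k m) (fun eta' => weight e (config_or eta eta') r) <=
   bern p (edges_between n0 k m) (fun eta' =>
     (1 + E4) * (lvl (conn (config_or eta eta')) r)%:R
     + (-1) * ((lvl (conn (config_or eta eta')) r)%:R *
      (~~ thin lam r (conn (config_or eta eta')))%:R)).
  apply: le_bern; first exact: edge_prob_itv01.
  move=> eta' _; rewrite /weight; set z := lvl _ _; set V := ballcard _ _.
  have /andP[q0 q1] := @discount_itv01 R n0 hn0 e e01.
  have -> : (1 + E4) * z%:R +
      -1 * (z%:R * (~~ thin lam r (conn (config_or eta eta')))%:R)
    = z%:R * (1 + E4 - (~~ thin lam r (conn (config_or eta eta')))%:R) by ring.
  rewrite -mulrA; apply: ler_wpM2l; first exact: ler0n.
  apply: (@le_trans _ _ ((1 - (e * n0%:R^-1) ^+ 2) ^+ V)).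
    by rewrite ler_piMl ?exprn_ge0 // exprn_ile1.
  have E40 : 0 < E4 by exact: expR_gt0.
  rewrite /thin -/V; have -> : (0 < r)%N by rewrite /r /m; lia.
  case: leqP => /= VR.
    by rewrite subr0 (@le_trans _ _ 1) ?exprn_ile1 //; lra.
  have -> : 1 + E4 - 1 = E4 by ring.
  apply: (@le_trans _ _ (expR (- (e * n0%:R^-1) ^+ 2) ^+ V)).
    apply: lerXn2r; rewrite ?nnegrE ?expR_ge0 //.
    exact: expR_ge1Dx.
  rewrite -expRM_natl ler_expR mulrN lerN2.
  have H : r%:R ^+ 2 <= lam%:R * V%:R :> R by rewrite -natrX -natrM ler_nat ltnW.
  have l0 : 0 < lam%:R :> R by rewrite ltr0n.
  rewrite -(ler_pM2l l0).
  have bE : b = 4 * n0%:R ^+ 2 * lam%:R by rewrite /b /bn natrM natrM natrX.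
  have -> : lam%:R * (4 * b) = r%:R ^+ 2 * (e / n0%:R) ^+ 2.
    transitivity ((e * r%:R) ^+ 2 / n0%:R ^+ 2); last by field; rewrite gt_eqF.
    by rewrite er bE; field; rewrite gt_eqF.
  by rewrite [leRHS]mulrA; apply: ler_wpM2r => //; exact: sqr_ge0.
have := le_trans HL HU.
rewrite bernD !bernZ bern_lvl // -/Z -/p; lra.
Qed.

(* The IIC probability that no scale up to [k] is thin. *)
Definition beta (lam k : nat) : R :=
  bern p (edges n0 k) (fun eta => (lvl (conn eta) k)%:R * (nothin lam k (conn eta))%:R).

Lemma eq_thin lam r (A A' : pred (vtx n0)) :
  (forall v, (size v < r)%N -> A v = A' v) -> thin lam r A = thin lam r A'.
Proof. by move=> /eq_ballcard; rewrite /thin => ->. Qed.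

(** Given generations up to [k], a thin scale already found persists and makes the integrand vanish;
    otherwise testing the single scale [k + m] multiplies the bound by 1 - c. Iterating gives (1 -
    c)^j. *)
Lemma beta_small (lam : nat) (eps : R) : (0 < lam)%N -> 0 < eps ->
  exists k, beta lam k <= eps.
Proof.
move=> lam0 eps0; have [c /andP[c0 c1] Hc] := bern_thin lam0.
have step k : exists m, beta lam (k + m) <= (1 - c) * beta lam k.
  have [m Hm] := Hc k; exists m.
  rewrite /beta edges_split bern_cat -bernZ.
  apply: le_bern; first exact: edge_prob_itv01.
  move=> eta /supported_edges sk.
  rewrite mulrA; case nt : (nothin lam k (conn eta)); rewrite ?mulr1 ?mulr0.
    apply: le_trans (Hm _ sk); apply: le_bern; first exact: edge_prob_itv01.
    move=> eta' _; apply: ler_wpM2l; first exact: ler0n.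
    rewrite -/(config_or eta eta') ler_nat; case h : (nothin _ _ _) => //.
    by move/allP: h => -> //; rewrite mem_iota; lia.
  rewrite -[leRHS](_ : bern p (edges_between n0 k m) (fun=> 0 * 0) = 0); last first.
    by rewrite bernZ mul0r.
  apply: le_bern; first exact: edge_prob_itv01.
  move=> eta' h'; rewrite (_ : nothin _ _ _ = false) ?mulr0 //.
  apply/negbTE; move/negbT: nt => /allPn[r]; rewrite mem_iota => rk.
  rewrite negbK => tr; apply/allPn; exists r; first by rewrite mem_iota; lia.
  rewrite negbK -(eq_thin lam (A := conn eta)) // => v vr.
  apply/esym/(@conn_or_low _ k); last lia.
  by move=> u /h'; rewrite mem_edges_between => /andP[].
have pow j : exists k, beta lam k <= (1 - c) ^+ j.
  elim: j => [|j [k IH]].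
    exists 0%N; rewrite expr0 /beta /= /lvl /nothin.
    by rewrite -natrM lern1 [count _ _]/= addn0 mul1n.
  have [m Hm] := step k; exists (k + m)%N; apply: (le_trans Hm).
  by rewrite exprS; apply: ler_wpM2l => //; lra.
have ce0 : 0 < c * eps by rewrite mulr_gt0.
(* For j > 1 / (c eps), (1 - c)^j <= exp(-c j) <= 1 / (1 + c j) <= eps. *)
pose j := (Num.truncn (c * eps)^-1).+1.
have jP : (c * eps)^-1 < j%:R by exact: truncnS_gt.
have [k Hk] := pow j; exists k; apply: (le_trans Hk).
apply: (@le_trans _ _ (expR (- c) ^+ j)).
  apply: lerXn2r; rewrite ?nnegrE ?expR_ge0 ?subr_ge0 //.
  exact: expR_ge1Dx.
rewrite -expRM_natl mulrN expRN -[eps]invrK lef_pV2 ?posrE ?expR_gt0 ?invr_gt0 //.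
apply: le_trans (expR_ge1Dx _); apply: (@le_trans _ _ (j%:R * c)); last lra.
by rewrite -ler_pdivrMr // -invfM mulrC ltW // mulrC.
Qed.

End Thin.

(** * The incipient infinite cluster *)

Definition infinite_tree {n0 : nat} (H : set (vtx n0)) : Prop :=
  [/\ H [::], forall i u, H (i :: u) -> H u &
      forall k, exists2 v, size v = k & H v].

Lemma measure_seq_bigcup (R : realType) d (T : measurableType d)
    (mu : {measure set T -> \bar R}) (I : choiceType) (s : seq I) (F : I -> set T) :
  uniq s -> trivIset [set` s] F -> (forall i, measurable (F i)) ->
  mu (\bigcup_(i in [set` s]) F i) = (\sum_(i <- s) mu (F i))%E.
Proof.
by move=> us tF mF; rewrite measure_fin_bigcup // -fsbig_seq.
Qed.

Section IIC.
Variables (R : realType) (n0 : nat).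
Hypothesis hn0 : (2 <= n0)%N.
Variables (d : measure_display) (Omega : measurableType d).
Variables (P : probability Omega R) (G : Omega -> set (vtx n0)).
Hypothesis IIC : IIC_law P G.
Let p : R := n0%:R^-1.

Lemma asbool_cluster eta k v : (size v <= k)%N ->
  `[< (Defs.cluster eta `&` Ble n0 k) v >] = conn eta v.
Proof.
move=> vk; apply/asboolP/idP => [[/cluster_conn //]|cv].
by split => //; apply/cluster_conn.
Qed.

Lemma lvl_cluster eta k :
  count (fun v => `[< (Defs.cluster eta `&` Ble n0 k) v >]) (level n0 k) =
  lvl (conn eta) k.
Proof. by apply: eq_lvl => v vk; apply: asbool_cluster; rewrite vk. Qed.

(** The law is prescribed on the atoms where [G w] has a given trace on [Ble n0 k]. [M] is the
    finite union of the atoms whose trace is a cluster satisfying [phi], which makes it measurable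
    and turns its probability into a size-biased expectation. *)
Lemma IIC_event k (phi : set (vtx n0) -> bool) :
  exists M, [/\ measurable M,
    M `<=` [set w | (exists eta, G w `&` Ble n0 k = Defs.cluster eta `&` Ble n0 k)
                    /\ phi (G w `&` Ble n0 k)] &
    P M = (bern p (edges n0 k) (fun eta => (lvl (conn eta) k)%:R *
            (phi (Defs.cluster eta `&` Ble n0 k))%:R))%:E].
Proof.
pose C (S : {set 'I_(size (edges n0 k))}) : set (vtx n0) :=
  Defs.cluster (@conf_of n0 k S) `&` Ble n0 k.
(* Different configurations may produce the same cluster, hence [undup]. *)
pose s := seq.filter phi (undup (map C (enum {set 'I_(size (edges n0 k))}))).

pose F (A : set (vtx n0)) := [set w | G w `&` Ble n0 k = A].
exists (\bigcup_(A in [set` s]) F A); split.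
- apply: fin_bigcup_measurable; first exact: finite_seq.
  by move=> A _; have [] := IIC k A.
- move=> w [A /=]; rewrite mem_filter => /andP[fA].
  rewrite mem_undup => /mapP[S _ AS]; rewrite /F /= => ->; split=> //.
  by exists (@conf_of n0 k S).
rewrite measure_seq_bigcup; last 3 first.
- by rewrite filter_uniq // undup_uniq.
- by move=> A B _ _ [w [/= <- <-]].
- by move=> A; have [] := IIC k A.
pose wt (S : {set 'I_(size (edges n0 k))}) :=
  p ^+ #|S| * (1 - p) ^+ (size (edges n0 k) - #|S|).
have E A : P (F A) = (\sum_S wt S * ((count (fun v => `[< A v >]) (level n0 k))%:R
    * (`[< C S = A >])%:R))%:E.
  have [_ ->] := IIC k A; congr EFin; rewrite /perc_prob mulr_sumr.
  by apply: eq_bigr => S _; rewrite mulrCA.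
rewrite (eq_bigr _ (fun A _ => E A)) sumEFin exchange_big /=; congr EFin.
rewrite -(sum_set_bern _ Defs.root).
apply: eq_bigr => S _; rewrite -mulr_sumr -/(wt S); congr (_ * _).
rewrite -[conf_seq _ _]/(@conf_of n0 k S) -/(C S) -lvl_cluster -/(C S).
have [fC|fC] := boolP (phi (C S)).
  rewrite (bigD1_seq (C S)) /=; last 2 first.
  - rewrite mem_filter fC mem_undup; apply/mapP; exists S => //.
    by rewrite mem_enum.
  - by rewrite filter_uniq // undup_uniq.
  rewrite big1 ?addr0; first by rewrite (asboolT (erefl (C S))).
  by move=> A /eqP AC; rewrite asboolF ?mulr0 // => /esym.
rewrite mulr0 big_seq big1 // => A; rewrite mem_filter => /andP[fA _].
by rewrite asboolF ?mulr0 // => CA; rewrite CA fA in fC.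
Qed.

Lemma bern_lvl_edges k :
  bern p (edges n0 k) (fun eta => (lvl (conn eta) k)%:R) = 1.
Proof.
have := @bern_lvl R n0 hn0 0 k (fun=> false).
have -> : config_or (fun=> false) = id :> ((vtx n0 -> bool) -> _).
  by apply/funext => eta; apply/funext.
rewrite add0n => -> //.
Qed.

Lemma negligible_setC (M : set Omega) : measurable M ->
  (forall eps : R, 0 < eps -> (P (~` M) <= eps%:E)%E) -> P.-negligible (~` M).
Proof.
move=> mM h; exists (~` M); split => //; first exact: measurableC.
apply/eqP; rewrite eq_le measure_ge0 andbT.
by apply/lee_addgt0Pr => e e0; rewrite add0e h.
Qed.

(** Size-biasing forbids extinction: restricting to a non-empty generation [k] leaves the integrand
    [lvl] unchanged, and its expectation is 1. Closure under parents is read off the cluster that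
    [G w] agrees with. *)
Lemma IIC_tree : {ae P, forall w, infinite_tree (G w)}.
Proof.
have H k : {ae P, forall w,
    (exists eta, G w `&` Ble n0 k = Defs.cluster eta `&` Ble n0 k) /\
    exists2 v, size v = k & G w v}.
  have [M [mM sM PM]] := IIC_event k
    (fun A => 0 < count (fun v => `[< A v >]) (level n0 k))%N.
  apply: (@negligibleS _ _ _ _ (~` M)).
    move=> w /= nw Mw; apply: nw; have [h1 h2] := sM w Mw; split=> //.
    rewrite -has_count in h2; have /hasP[v vk /asboolP[Gv _]] := h2.
    by exists v => //; apply/eqP; rewrite -mem_level.
  apply: negligible_setC => // eps eps0; rewrite probability_setC //.
  rewrite PM (eq_bern _ (g' := fun eta => (lvl (conn eta) k)%:R)).
    by rewrite bern_lvl_edges -EFinB subrr lee_fin ltW.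
  by move=> eta _; rewrite lvl_cluster; case: (lvl _ _) => [|m]; rewrite ?mul0r ?mulr1.
have := ae_foralln H; apply: filterS => w Hw; split.
- have [[eta e] _] := Hw 0%N.
  have : (Defs.cluster eta `&` Ble n0 0) [::] by split => //; apply/cluster_conn.
  by rewrite -e => -[].
- move=> i u Giu; have [[eta e] _] := Hw (size u).+1.
  have : (Defs.cluster eta `&` Ble n0 (size u).+1) (i :: u).
    by rewrite -e; split=> //; rewrite /Ble /=.
  move=> [/cluster_conn /= /andP[_ cu] _].
  have : (Defs.cluster eta `&` Ble n0 (size u).+1) u.
    by split; [apply/cluster_conn|rewrite /Ble /=].
  by rewrite -e => -[].
- by move=> k; have [_] := Hw k.
Qed.

(** For each [lam], a thin scale up to [k] exists with probability 1 - [beta], which tends to 1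
    along suitable [k]; only countably many values of [lam] occur. *)
Lemma IIC_thin : {ae P, forall w, forall lam, (0 < lam)%N ->
  exists r, thin lam r (fun v => `[< G w v >])}.
Proof.
suff H lam : {ae P, forall w,
    exists r, thin lam.+1 r (fun v => `[< G w v >])}.
  have := ae_foralln H; apply: filterS => w Hw [//|lam] _; exact: Hw.
have /choice[M HM] : forall k, exists M, [/\ measurable M,
    M `<=` [set w | exists r, thin lam.+1 r (fun v => `[< G w v >])] &
    P M = (1 - beta R n0 lam.+1 k)%:E].
  move=> k; have [M [mM sM PM]] := IIC_event k
    (fun A => ~~ nothin lam.+1 k (fun v => `[< A v >])).
  exists M; split => //.
    move=> w /sM[_ /allPn[r]]; rewrite mem_iota negbK => rk h; exists r.
    rewrite -(eq_thin _ (A := fun v => `[< (G w `&` Ble n0 k) v >])) // => v vr.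
    apply/asboolP/asboolP => [[]//|Gv]; split => //.
    rewrite /Ble /=; lia.
  rewrite PM; congr EFin.
  rewrite -[X in X - _](bern_lvl_edges k) /beta -mulN1r -bernZ -bernD.
  apply: eq_bern => eta _.
  have -> : nothin lam.+1 k (fun v => `[< (Defs.cluster eta `&` Ble n0 k) v >]) =
            nothin lam.+1 k (conn eta).
    apply: eq_in_all => r; rewrite mem_iota => rk; congr negb.
    by apply: eq_thin => v vr; apply: asbool_cluster; lia.
  by case: (nothin _ _ _); rewrite ?mulr1 ?mulr0 ?addr0 // mulN1r subrr.
have mU : measurable (\bigcup_k M k).
  by apply: bigcup_measurable => k _; have [] := HM k.
apply: (@negligibleS _ _ _ _ (~` \bigcup_k M k)).
  by move=> w /= nw [k _ Mk]; apply: nw; have [_ + _] := HM k; apply.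
apply: negligible_setC => // eps eps0.
have [k bk] := beta_small hn0 (ltn0Sn lam) eps0.
have [mM _ PM] := HM k.
apply: (@le_trans _ _ (P (~` M k))).
  apply: le_measure; rewrite ?inE; [exact: measurableC|exact: measurableC|].
  by apply: subsetC => w Mw; exists k.
rewrite probability_setC // PM -EFinB lee_fin; lra.
Qed.

End IIC.

(** * Compact sets of cadlag paths *)

Section Skorokhod.
Variable R : realType.

(** Near each t, right continuity bounds f on the right and the left limit bounds it on the left;
    compactness of [0, T] makes the bound uniform. *)
Lemma cadlag_bounded (f : R -> R) (T : R) : cadlag R f ->
  exists C, forall t, 0 <= t <= T -> `|f t| <= C.
Proof.
move=> [fr fl].
have : compact `[0, T] by exact: segment_compact.
rewrite compact_near_coveringP.
move=> cov.
suff : \forall C \near +oo, `[0, T] `<=` (fun s => 0 <= s -> `|f s| <= C).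
  move=> /filter_ex[C hC]; exists C => t /[dup] /andP[t0 _] tT.
  by apply: hC; rewrite //= in_itv.
apply: (cov R (pinfty_nbhs R) (fun C s => 0 <= s -> `|f s| <= C)).
move=> t; rewrite /= in_itv /= => /andP[t0 tT].
have R1 : \forall s \near t, t < s -> `|f s| <= `|f t| + 1.
  have := fr t t0; move/cvgr_norm_le => /(_ (`|f t| + 1)); apply.
  by rewrite ltrDl.
have [C L1] : exists C, \forall s \near t, 0 <= s -> s < t -> `|f s| <= C.
  have [t1|t1] := ltP 0 t; last first.
    (* At t = 0 no point of the half-line lies on the left, so any constant will do. *)
    by exists 0; near=> s => s0 st; lra.
  have /cvg_ex[l cl] := fl t t1; exists (`|l| + 1).
  move/cvgr_norm_le : cl => /(_ (`|l| + 1)) h.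
  have {}h : \forall s \near t, s < t -> `|f s| <= `|l| + 1.
    by apply: h; rewrite ltrDl.
  by apply: filterS h => s h _.
exists ([set s | (t < s -> `|f s| <= `|f t| + 1) /\
                 (0 <= s -> s < t -> `|f s| <= C)],
        [set D | `|f t| + 1 <= D /\ C <= D]).
  split; first by near=> s; split; near: s.
  near=> D; split; near: D; apply: nbhs_pinfty_ge; exact: num_real.
move=> [s D] /= [[h1 h2] [D1 D2]] s0.
have [st|ts|->] := ltgtP s t.
- by apply: le_trans D2; exact: h2.
- by apply: le_trans D1; exact: h1.
- by apply: le_trans D1; rewrite lerDl.
Unshelve. all: by end_near. Qed.

(** Otherwise choose paths in [K] exceeding n somewhere on [0, 1]. Along a convergent subsequence
    they come within 1 of the limit at times that the time change moves by less than 1, yet the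
    limit is bounded on [0, 2]. *)
Lemma D_compact_bounded (K : set (R -> R)) : D_compact R K ->
  exists C, forall f, K f -> forall t, 0 <= t <= 1 -> `|f t| <= C.
Proof.
move=> [Kc Kseq]; apply: contrapT => nC.
have /choice[x xP] : forall n : nat, exists f,
    K f /\ exists t, 0 <= t <= 1 /\ n%:R < `|f t|.
  move=> n; apply: contrapT => nf; apply: nC; exists n%:R => f Kf t t01.
  rewrite leNgt; apply/negP => ft; apply: nf; exists f; split=> //.
  by exists t.
have [phi [y [phi_mono Ky [lam [lamP lamc]]]]] := Kseq x (fun n => (xP n).1).
have [C HC] := @cadlag_bounded y 2 (Kc _ Ky).
have [N HN] := lamc 1 ltr01 1 ltr01.
have phi_ge n : (n <= phi n)%N.
  elim: n => // n IH; apply: leq_ltn_trans IH _; exact: phi_mono.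
pose n := maxn N (Num.truncn (C + 1)).+1.
have [_ [t [t01 /= xt]]] := xP (phi n).
have [l1 l2] := HN n (leq_maxl _ _) t t01.
have [l0 _ _] := lamP n.
have /andP[t0 t1] := t01.
have := HC (lam n t); rewrite l0 //=.
have -> : lam n t <= 2.
  by have := ler_norm (lam n t - t); lra.
move=> /(_ isT) yC.
have C1 : C + 1 < (phi n)%:R.
  apply: lt_le_trans (truncnS_gt _) _; rewrite ler_nat.
  exact: leq_trans (leq_maxr _ _) (phi_ge _).
have := ler_normD (x (phi n) t - y (lam n t)) (y (lam n t)).
rewrite subrK; rewrite /= in l2; lra.
Qed.

End Skorokhod.

(** * Green function of the killed walk *)

Lemma ler_sum_subset (R : numDomainType) (T : eqType) (s1 s2 : seq T) (F : T -> R) :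
  (forall x, 0 <= F x) -> uniq s1 -> {subset s1 <= s2} ->
  \sum_(x <- s1) F x <= \sum_(x <- s2) F x.
Proof.
move=> F0; elim: s1 s2 => [|x s1 IH] s2; first by rewrite big_nil sumr_ge0.
move=> /= /andP[xs1 us1] sub.
have xs2 : x \in s2 by apply: sub; rewrite inE eqxx.
rewrite big_cons (big_rem x xs2) /= lerD2l; apply: IH => // y ys1.
have := sub y; rewrite inE ys1 orbT (perm_mem (perm_to_rem xs2)) inE.
move=> /(_ isT) /orP[/eqP yx|//].
by rewrite -yx ys1 in xs1.
Qed.

Section TreeWalk.
Variables (R : realType) (n0 : nat) (H : set (vtx n0)).
Hypothesis HT : infinite_tree H.
Implicit Types (x y v : vtx n0) (B : seq (vtx n0)).
Let Hb : pred (vtx n0) := fun v => `[< H v >].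

Lemma tree_nbrs_uniq x : uniq (tree_nbrs x).
Proof.
have um : uniq [seq i :: x | i <- enum 'I_n0].
  by rewrite map_inj_uniq ?enum_uniq // => i j [].
rewrite /tree_nbrs; case: x um => [|i u] um //=; rewrite um andbT.
apply/negP => /mapP[j _ /(congr1 size) /=] /eqP; lia.
Qed.

Lemma size_tree_nbrs x : (size (tree_nbrs x) <= n0.+1)%N.
Proof.
by rewrite /tree_nbrs size_cat size_map size_enum_ord; case: x => [|i u] /=; lia.
Qed.

Lemma tree_adj_sym x y : tree_adj x y = tree_adj y x.
Proof. by apply/tree_adjP/tree_adjP => -[]; [right|left|right|left]. Qed.

Lemma tree_suffix l v : H (l ++ v) -> H v.
Proof. by have [_ HC _] := HT; elim: l => //= i l IH /HC. Qed.

Lemma deg_gt0 x : H x -> (0 < deg H x)%N.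
Proof.
have [_ HC Hinf] := HT; move=> Hx; rewrite /deg -has_count.
case: x Hx => [|i u] Hx.
  have [[|i [|//]] //= _ Hi] := Hinf 1%N.
  apply/hasP; exists [:: i]; last exact/asboolP.
  exact: tree_adj_child.
apply/hasP; exists u; first by rewrite /tree_nbrs inE eqxx.
by apply/asboolP; exact: HC Hx.
Qed.

(* [stay_mass B m y] is the probability that the jump chain is at [y] at step
   [m] and was in [B] at all earlier steps. *)
Fixpoint stay_mass B m : vtx n0 -> R := fun y =>
  if m is m'.+1 then \sum_(x <- B) stay_mass B m' x * trans R H x y
  else (y == Defs.root)%:R.

Lemma trans_ge0 x y : 0 <= trans R H x y.
Proof. by rewrite /trans; case: ifP => // _; rewrite invr_ge0. Qed.

Lemma stay_mass_ge0 B m y : 0 <= stay_mass B m y.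
Proof.
elim: m y => [|m IH] y //=; apply: sumr_ge0 => x _.
by rewrite mulr_ge0 ?trans_ge0.
Qed.

Lemma stay_mass_supp B m y : stay_mass B m y != 0 -> H y /\ (size y <= m)%N.
Proof.
elim: m y => [|m IH] y /=.
  by have [-> _|_] := eqVneq y Defs.root; rewrite ?eqxx //; have [? _ _] := HT.
apply: contra_neqP => nH; apply: big1_seq => x _.
have [->|massx] := eqVneq (stay_mass B m x) 0; first by rewrite mul0r.
have [Hx xm] := IH _ massx.
rewrite /trans; case: ifP => [/andP[/asboolP Hy /tree_adjP xy]|]; last by rewrite mulr0.
exfalso; apply: nH; split => //.
by case: xy => -[i e]; move: xm; rewrite e /=; lia.
Qed.

Lemma sum_trans N x : H x -> (size x < N)%N ->
  \sum_(y <- balllist n0 N.+1) trans R H x y = 1.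
Proof.
move=> Hx xN; rewrite /trans -big_mkcond /= -big_filter.
rewrite (perm_big [seq y <- tree_nbrs x | `[< H y >]]); last first.
  apply: uniq_perm => [||y].
  - by apply: filter_uniq; exact: balllist_uniq.
  - by apply: filter_uniq; exact: tree_nbrs_uniq.
  rewrite !mem_filter /tree_adj mem_balllist; case yx: (y \in tree_nbrs x).
    rewrite andbT; case: (`[< H y >]) => //=.
    by move/tree_adjP: yx => -[] [i e]; rewrite e /= in xN *; lia.
  by rewrite !andbF.
rewrite big_const_seq count_predT size_filter -/(deg H x) iter_addr_0.
by rewrite -[_^-1 *+ _]mulr_natl mulfV // pnatr_eq0 -lt0n deg_gt0.
Qed.

(** Each jump increases the depth by at most one, so this ball cannot be left within [N] steps and
    no mass is lost. *)
Lemma stay_mass_total N m : (m <= N)%N ->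
  \sum_(y <- balllist n0 N.+1) stay_mass (balllist n0 N.+1) m y = 1.
Proof.
set B := balllist n0 N.+1; elim: m => [|m IH] mN /=.
  rewrite (bigD1_seq Defs.root) ?mem_balllist ?balllist_uniq //=.
  by rewrite big1 ?addr0 // => y /negbTE ->.
rewrite exchange_big /= -[RHS](IH (ltnW mN)); apply: eq_bigr => x _.
rewrite -mulr_sumr; have [->|/stay_mass_supp[Hx xm]] := eqVneq (stay_mass B m x) 0.
  by rewrite mul0r.
by rewrite sum_trans ?mulr1 //; lia.
Qed.

Section Green.
Variable v : vtx n0.
Hypothesis Hv : H v.
Let r := size v.
Let B := balllist n0 r.

(** Depth of the last common ancestor of [x] and [v]: ancestors of a word are its suffixes, and
    those of [x] other than the root that are also suffixes of [v] are counted. *)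
Fixpoint common x : nat := if x is i :: u then common u + suffix x v else 0.

Lemma common_le x : (common x <= r)%N.
Proof.
suff: (common x <= r)%N && (common x <= size x)%N by case/andP.
elim: x => //= i u /andP[IH1 IH2].
have [/size_suffix|_] := boolP (suffix (i :: u) v).
  by rewrite -/r /=; lia.
by rewrite addn0 IH1 /=; lia.
Qed.

Let pot x : R := r%:R - (common x)%:R.

Lemma pot_ge0 x : 0 <= pot x.
Proof. by rewrite subr_ge0 ler_nat common_le. Qed.

(* [pot] is the unit flow potential of the path from the root to [v], constant
   on the branches off that path; it dominates the Green function of the walk
   killed on leaving the ball, divided by the degree. *)
Lemma pot_super y : H y -> (size y < r)%N ->
  (y == Defs.root)%:R + \sum_(x <- tree_nbrs y | `[< H x >]) pot x <=
  (deg H y)%:R * pot y.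
Proof.
move=> Hy yr.
have -> : (deg H y)%:R * pot y = \sum_(x <- tree_nbrs y | `[< H x >]) pot y.
  by rewrite big_const_seq iter_addr_0 mulr_natl.
rewrite -subr_ge0 opprD addrCA -sumrB addrC subr_ge0.
rewrite /tree_nbrs big_cat /=.
(* No child has a larger potential than [y]. If [y] lies on the path to [v], it does so strictly
   before [v], and the child towards [v] has potential one less. This drop balances the rise towards
   the parent or, at the root, the unit source. *)
have child : (suffix y v)%:R <=
    \sum_(x <- [seq i :: y | i <- enum 'I_n0] | `[< H x >]) (pot y - pot x).
  rewrite big_map big_mkcond /=.
  have F0 i : 0 <= (if `[< H (i :: y) >] then pot y - pot (i :: y) else 0).
    by case: ifP => // _; rewrite /pot /= natrD; case: (suffix _ _) => /=; lra.
  case: (boolP (suffix y v)) => [/suffixP[l e]|_]; last exact: sumr_ge0.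
  case/lastP: l e => [/(congr1 size) /=|l i e]; first by rewrite -/r; lia.
  have e' : v = l ++ i :: y by rewrite e cat_rcons.
  have Hiy : H (i :: y) by apply: (@tree_suffix l); rewrite -e'.
  rewrite (bigD1_seq i) ?mem_enum ?enum_uniq //= asboolT // -[leLHS]addr0.
  apply: lerD; last by apply: sumr_ge0.
  have -> : pot y - pot (i :: y) = (suffix (i :: y) v)%:R.
    by rewrite /pot /= natrD; ring.
  by rewrite (_ : suffix (i :: y) v = true) //; apply/suffixP; exists l.
apply: le_trans (lerD (lexx _) child).
case: y Hy {yr child} => [|i u] Hy /=.
  by rewrite suffix0s big_nil add0r.
rewrite big_mkcond big_seq1 asboolT; last by have [_ HC _] := HT; exact: HC Hy.
by rewrite /pot /= natrD; lra.
Qed.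

(** Decomposing at the last step, the Green function truncated at [m.+1] is the source plus the
    function truncated at [m] transported by one jump. The factor deg(x) of the inductive bound
    cancels the jump probability 1 / deg(x), and [pot_super] closes the induction. *)
Lemma green_bound m y : y \in B ->
  \sum_(i < m) stay_mass B i y <= (Hb y)%:R * (deg H y)%:R * pot y.
Proof.
elim: m y => [|m IH] y yB.
  by rewrite big_ord0 !mulr_ge0 ?pot_ge0.
have [/asboolP Hy|/asboolPn nHy] := boolP (Hb y); last first.
  rewrite big1 ?mul0r // => i _.
  by apply/eqP/negPn/negP => /stay_mass_supp[].
rewrite mul1r; apply: le_trans (pot_super Hy _); last by rewrite -mem_balllist.
rewrite big_ord_recl /= lerD2l exchange_big /=.
apply: (@le_trans _ _ (\sum_(x <- B | `[< H x >] && tree_adj x y) pot x)).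
  rewrite [leRHS]big_mkcond big_seq [leRHS]big_seq; apply: ler_sum => x xB.
  rewrite -mulr_suml.
  have [/asboolP Hx|nHx] := boolP `[< H x >]; last first.
    rewrite big1 ?mul0r // => i _; apply/eqP; apply: contraNT nHx.
    by move=> /stay_mass_supp[Hx _]; apply/asboolP.
  rewrite /trans (asboolT Hy) /=; case: ifP => _; last by rewrite mulr0.
  rewrite ler_pdivrMr ?ltr0n ?deg_gt0 // mulrC; apply: (le_trans (IH _ xB)).
  by rewrite /Hb asboolT // mul1r.
rewrite -[leLHS]big_filter -[leRHS]big_filter; apply: ler_sum_subset.
- exact: pot_ge0.
- by rewrite filter_uniq // balllist_uniq.
move=> x; rewrite !mem_filter => /andP[/andP[-> xy] _] /=.
by rewrite tree_adj_sym in xy.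
Qed.

(** Bounds the mean number of jumps before exit: each vertex of the ball contributes at most its
    degree, at most n0 + 1, times a potential of at most [r]. *)
Lemma sum_stay_mass_le m : \sum_(i < m) \sum_(y <- B) stay_mass B i y <=
  (r * n0.+1 * ballcard Hb r)%:R.
Proof.
rewrite exchange_big /=.
apply: (@le_trans _ _ (\sum_(y <- B) (Hb y)%:R * (r * n0.+1)%:R)).
  rewrite big_seq [leRHS]big_seq; apply: ler_sum => y yB.
  apply: (le_trans (green_bound _ yB)); rewrite -mulrA; apply: ler_wpM2l => //.
  rewrite natrM mulrC; apply: ler_pM; rewrite ?pot_ge0 //.
    by rewrite lerBlDr lerDl.
  rewrite ler_nat; apply: leq_trans (size_tree_nbrs y); exact: count_size.
rewrite -mulr_suml [leRHS]natrM mulrC; apply: ler_wpM2l => //.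
by rewrite -natr_sum ler_nat -count_balllist -sum1_count [leqRHS]big_mkcond.
Qed.

End Green.
End TreeWalk.

(** * Law of the walk *)

Lemma measurable_forall_le d (T : measurableType d) (F : nat -> set T) m :
  (forall i, measurable (F i)) -> measurable [set w | forall i, (i <= m)%N -> F i w].
Proof.
move=> mF; rewrite (_ : [set w | _] = \bigcap_(i in [set i | (i <= m)%N]) F i).
  by apply: bigcap_measurable => //; exists 0%N.
by apply/seteqP; split => w h i; exact: h.
Qed.

Section PathLaw.
Variables (R : realType) (n0 : nat) (H : set (vtx n0)).
Variables (d : measure_display) (W : measurableType d) (Q : probability W R).
Variables (X : nat -> W -> vtx n0) (E : nat -> W -> R).
Hypothesis law : walk_law H Q X E.
Implicit Types (B : seq (vtx n0)).

Let mX i v : measurable [set w | X i w = v]. Proof. by have [+ _ _] := law. Qed.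

Lemma measurable_holding i (s : R) : measurable [set w | s < E i w].
Proof.
have [_ mE _] := law.
have := mE i measurableT `]s, +oo[%classic (measurable_itv _).
rewrite setTI; congr (measurable _).
by apply/seteqP; split => w /=; rewrite in_itv /= andbT.
Qed.

Lemma measurable_position i B : measurable [set w | X i w \in B].
Proof.
rewrite (_ : [set w | _] = \bigcup_(v in [set` B]) [set w | X i w = v]).
  by apply: fin_bigcup_measurable; [exact: finite_seq|move=> v _; exact: mX].
apply/seteqP; split => [w /= wB|w [v /= vB ->] //].
by exists (X i w).
Qed.

(* The first [j] positions are only required to lie in [B], the later ones are
   prescribed; summing over the [j]-th position gives an induction on [j]. *)
Definition path_event B (j m : nat) (x : nat -> vtx n0) (s : nat -> R) : set W :=
  [set w | forall i, (i <= m)%N ->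
    (if (i < j)%N then X i w \in B else X i w == x i) /\ s i < E i w].

Lemma measurable_path_event B j m x s : measurable (path_event B j m x s).
Proof.
apply: (@measurable_forall_le _ _ (fun i => [set w |
  (if (i < j)%N then X i w \in B else X i w == x i) /\ s i < E i w])) => i.
apply: measurableI; last exact: measurable_holding.
case: (i < j)%N; first exact: measurable_position.
rewrite -/([set w | X i w == x i]).
suff -> : [set w | X i w == x i] = [set w | X i w = x i] by exact: mX.
by apply/seteqP; split => w /= /eqP.
Qed.

Definition upd (x : nat -> vtx n0) j y : nat -> vtx n0 :=
  fun i => if i == j then y else x i.

Lemma path_eventS B j m x s : (j <= m)%N ->
  path_event B j.+1 m x s =
  \bigcup_(y in [set` B]) path_event B j m (upd x j y) s.
Proof.
move=> jm; apply/seteqP; split => [w Ew|w [y /= yB Ew] i im].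
  have [] := Ew _ jm; rewrite ltnSn => XB _.
  exists (X j w) => // i im; have [] := Ew _ im; rewrite ltnS leq_eqVlt /upd.
  by have [->|ij] := eqVneq i j; rewrite ?ltnn ?eqxx.
have [] := Ew _ im; rewrite ltnS [(i <= j)%N]leq_eqVlt /upd.
have [->|ij] := eqVneq i j; last by move=> ? ?; split.
by rewrite ltnn /= => /eqP -> ?; split.
Qed.

Lemma path_event_bigcup B j m x s : uniq B -> (j <= m)%N ->
  Q (path_event B j.+1 m x s) =
  (\sum_(y <- B) Q (path_event B j m (upd x j y) s))%E.
Proof.
move=> uB jm; rewrite path_eventS // measure_seq_bigcup //.
  move=> y z _ _ [w [/(_ _ jm)[+ _] /(_ _ jm)[+ _]]].
  by rewrite ltnn /upd eqxx => /eqP -> /eqP.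
by move=> y; exact: measurable_path_event.
Qed.

Lemma path_eventE B j m x s : uniq B -> (forall i, 0 <= s i) -> (j <= m)%N ->
  Q (path_event B j m x s) =
  (stay_mass R H B j (x j) * \prod_(j <= i < m) trans R H (x i) (x i.+1)
   * \prod_(i < m.+1) expR (- s i))%:E.
Proof.
move=> uB s0; elim: j x => [|j IH] x jm.
  have [_ _ hl] := law; have := hl m x s s0; rewrite big_mkord => <-.
  congr (Q _); apply/seteqP; split => w Ew i im; have [] := Ew i im => /=.
    by move=> /eqP.
  by move=> ->.
rewrite path_event_bigcup ?(ltnW jm) //.
rewrite (eq_bigr _ (fun y _ => IH (upd x j y) (ltnW jm))) sumEFin; congr EFin.
rewrite /= -mulr_suml; congr (_ * _).
rewrite mulr_suml; apply: eq_bigr => y _.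
rewrite big_ltn // mulrA; congr (_ * _).
  by rewrite /upd eqxx gtn_eqF.
rewrite big_nat_cond [RHS]big_nat_cond; apply: eq_bigr => i /andP[/andP[ji _] _].
by rewrite /upd !gtn_eqF //; lia.
Qed.

Lemma stay_prob B m s : uniq B -> (forall i, 0 <= s i) ->
  Q [set w | forall i, (i <= m)%N -> X i w \in B /\ s i < E i w] =
  ((\sum_(y <- B) stay_mass R H B m y) * \prod_(i < m.+1) expR (- s i))%:E.
Proof.
move=> uB s0; pose x (i : nat) : vtx n0 := [::].
have -> : [set w | forall i, (i <= m)%N -> X i w \in B /\ s i < E i w] =
    path_event B m.+1 m x s.
  by apply/seteqP; split => w Ew i im; have := Ew i im; rewrite ltnS im.
rewrite path_event_bigcup //.
rewrite (eq_bigr _ (fun y _ => path_eventE (upd x m y) uB s0 (leqnn m))).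
rewrite sumEFin; congr EFin; rewrite mulr_suml; apply: eq_bigr => y _.
by rewrite big_geq // mulr1 /upd eqxx.
Qed.

Lemma measurable_stay B m s :
  measurable [set w | forall i, (i <= m)%N -> X i w \in B /\ s i < E i w].
Proof.
apply: (@measurable_forall_le _ _ (fun i => [set w | X i w \in B /\ s i < E i w])) => i.
by apply: measurableI; [exact: measurable_position|exact: measurable_holding].
Qed.

(** The law constrains holding times only jointly with positions. Asking the walk to be in a ball
    too large to be left costs nothing, and zero thresholds then give probability 1. *)
Lemma holding_gt0 : infinite_tree H ->
  Q.-negligible (~` [set w | forall i, 0 < E i w]).
Proof.
move=> HT.
have N m : Q.-negligible (~` [set w | forall i, (i <= m)%N ->
    X i w \in balllist n0 m.+1 /\ 0 < E i w]).
  exists (~` [set w | forall i, (i <= m)%N ->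
    X i w \in balllist n0 m.+1 /\ 0 < E i w]).
  have mS := @measurable_stay (balllist n0 m.+1) m (fun=> 0).
  split=> //; first exact: measurableC.
  rewrite probability_setC // (@stay_prob _ _ (fun=> 0)) ?balllist_uniq //.
  rewrite stay_mass_total // big1; last by move=> i _; rewrite oppr0 expR0.
  by rewrite mulr1 -EFinB subrr.
apply: negligibleS (negligible_bigcup N) => w /= nE.
apply: contrapT => nU; apply: nE => i; apply: contrapT => Ei; apply: nU.
by exists i => // /(_ i (leqnn i)) [].
Qed.

End PathLaw.

(** * Exit times *)

(** Markov's inequality in a form whose only input is the probabilities of the events [A i], which
    is what [stay_prob] supplies. *)
Lemma markov_indic_sum (R : realType) d (W : measurableType d) (Q : probability W R)
    (I : Type) (s : seq I) (c : I -> R) (A : I -> set W) (q : I -> R) (t : R) :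
  (forall i, 0 <= c i) -> (forall i, measurable (A i)) ->
  (forall i, Q (A i) = (q i)%:E) ->
  let F := [set w | t <= \sum_(i <- s) c i * \1_(A i) w] in
  measurable F /\ (t%:E * Q F <= (\sum_(i <- s) c i * q i)%:E)%E.
Proof.
move=> c0 mA QA F.
have mf i : measurable_fun setT (fun w => c i * \1_(A i) w : R).
  by apply: measurable_funM => //; exact: measurable_indic.
have msum : measurable_fun setT (fun w => \sum_(i <- s) c i * \1_(A i) w : R).
  exact: measurable_sum.
have mF : measurable F.
  have := msum measurableT `[t, +oo[%classic (measurable_itv _).
  rewrite setTI; congr (measurable _).
  by apply/seteqP; split => w /=; rewrite in_itv /= andbT.
split => //.
have mE i : measurable_fun setT (fun w => (c i * \1_(A i) w)%:E : \bar R).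
  exact/measurable_EFinP.
have -> : (\sum_(i <- s) c i * q i)%:E =
    (\int[Q]_w (\sum_(i <- s) (c i * \1_(A i) w)%:E))%E.
  rewrite ge0_integral_sum //; last first.
    by move=> i w _; rewrite lee_fin mulr_ge0 // indicE.
  rewrite -sumEFin; apply: eq_bigr => i _.
  under eq_integral do rewrite EFinM.
  rewrite ge0_integralZl //; last 2 first.
  - by apply/measurable_EFinP; exact: measurable_indic.
  - by rewrite lee_fin.
  by rewrite integral_indic // setIT EFinM; congr (_ * _)%E; exact/esym/QA.
have g0 w : (0 <= \sum_(i <- s) (c i * \1_(A i) w)%:E)%E.
  by apply: sume_ge0 => i _; rewrite lee_fin mulr_ge0 // indicE.
have mg : measurable_fun setT (fun w => \sum_(i <- s) (c i * \1_(A i) w)%:E : \bar R)%E.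
  by under eq_fun do rewrite sumEFin; exact/measurable_EFinP.
apply: (@le_trans _ _ (\int[Q]_(w in F) (\sum_(i <- s) (c i * \1_(A i) w)%:E))%E).
  have [t0|t0] := leP 0 t; last first.
    apply: (@le_trans _ _ 0%E); last by apply: integral_ge0.
    by rewrite mule_le0_ge0 // lee_fin ltW.
  rewrite -integral_cst //; apply: ge0_le_integral => //.
  - by apply: measurable_funTS.
  - by move=> w Fw; rewrite sumEFin lee_fin.
by apply: ge0_subset_integral.
Qed.

(** Discrete layer-cake bound, replacing a holding time by the events that it exceeds j. *)
Lemma le_sum_gt_nat (R : realType) (x : R) (J : nat) : x <= J%:R ->
  x <= \sum_(j < J) (j%:R < x)%R%:R.
Proof.
elim: J => [|J IH] xJ; first by rewrite big_ord0.
rewrite big_ord_recr /=; have [h|h] := leP x J%:R.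
  by rewrite (le_trans (IH h)) // lerDl.
rewrite (le_trans xJ) // -natr1 lerD2r.
rewrite (eq_bigr (fun=> 1)); first by rewrite sumr_const card_ord.
by move=> j _; rewrite (le_lt_trans _ h) // ler_nat ltnW.
Qed.

Lemma sum_expRN (R : realType) (J : nat) : \sum_(j < J) expR (- j%:R) <= 2 :> R.
Proof.
have e2 : expR (- 1) <= 2^-1 :> R.
  rewrite expRN lef_pV2 ?posrE ?expR_gt0 //.
  by apply: le_trans (expR_ge1Dx 1); lra.
suff : \sum_(j < J) expR (- j%:R) <= 2 - 2 * 2^-1 ^+ J :> R.
  have : 0 <= 2^-1 ^+ J :> R by rewrite exprn_ge0 // invr_ge0.
  lra.
elim: J => [|J IH]; first by rewrite big_ord0 expr0; lra.
rewrite big_ord_recr /= exprS.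
have : expR (- J%:R) <= 2^-1 ^+ J :> R.
  by rewrite -[_%:R]mulr1 -mulrN expRM_natl lerXn2r // nnegrE ?expR_ge0 // invr_ge0.
lra.
Qed.

Section ExitTime.
Variables (R : realType) (n0 : nat) (H : set (vtx n0)).
Hypothesis HT : infinite_tree H.
Variables (d : measure_display) (W : measurableType d) (Q : probability W R).
Variables (X : nat -> W -> vtx n0) (E : nat -> W -> R).
Hypothesis law : walk_law H Q X E.

(** Positive holding times make the jump times strictly increasing, so [k] is the only index that
    [xget] can select. *)
Lemma Ywalk_jtime w k : (forall i, 0 < E i w) -> Ywalk R X E w (jtime R E k w) = X k w.
Proof.
move=> E0; rewrite /Ywalk; congr (X _ w).
have jS i : jtime R E i.+1 w = jtime R E i w + E i w by rewrite /jtime big_ord_recr.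
have jm i j : (i <= j)%N -> jtime R E i w <= jtime R E j w.
  move=> /subnK <-; elim: (j - i)%N => // a IH.
  by rewrite addSn jS (le_trans IH) // lerDl ltW.
apply: xget_subset1 => /=.
  by rewrite lexx jS ltrDl E0.
suff u i : jtime R E i w <= jtime R E k w < jtime R E i.+1 w -> i = k.
  by move=> i j /u -> /u ->.
move=> /andP[h1 h2]; apply/eqP; rewrite eqn_leq; apply/andP; split.
  rewrite leqNgt; apply/negP => /jm; rewrite jS.
  by have := E0 k; lra.
by rewrite leqNgt; apply/negP => /jm; lra.
Qed.

(** The bad event [F] is that a weighted sum of indicators reaches n = 16 M. Its mean is at most M +
    2 M + M = 4 M, a quarter of n: M for a late exit, 2 M for the time spent, M for a long holding
    time. *)
Lemma fast_exit (r : nat) : (0 < r)%N ->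
  let n := (16 * (r * n0.+1 * ballcard (fun v => `[< H v >]) r))%N in
  (0 < n)%N /\ exists F, [/\ measurable F, (Q F <= (4^-1)%:E)%E &
    forall w, ~ F w -> (forall i, 0 < E i w) ->
      exists t, 0 <= t <= 1 /\ (r <= size (Ywalk R X E w (n%:R * t)))%N].
Proof.
move=> r0; set M := (r * n0.+1 * _)%N => n.
have M0 : (0 < M)%N.
  rewrite /M !muln_gt0 r0 /= /ballcard; case: (r) r0 => // r' _.
  rewrite big_ord_recl ltn_addr // /lvl /=.
  by have [Hr _ _] := HT; rewrite asboolT.
have n0' : (0 < n)%N by rewrite /n; lia.
split => //.
have [v vr Hv] : exists2 v, size v = r & H v by have [_ _] := HT.
pose B := balllist n0 r; pose a m := \sum_(y <- B) stay_mass R H B m y.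
have a0 m : 0 <= a m by apply: sumr_ge0 => y _; exact: stay_mass_ge0.
have aM m : \sum_(i < m) a i <= M%:R.
  by have := @sum_stay_mass_le R n0 H HT v Hv m; rewrite vr.
(* The n terms [a i] add up to at most M = n / 16, so they cannot all exceed 1/16. *)
have [N Nn aN] : exists2 N, (N < n)%N & a N <= 16^-1.
  apply: contrapT => nN.
  have : \sum_(i < n) 16^-1 < \sum_(i < n) a i.
    have := n0'; case: (n) nN => // n' nN _.
    apply: ltr_sum; first by apply/hasP; exists ord0; rewrite ?mem_index_enum.
    move=> i _; rewrite ltNge; apply/negP => ai; apply: nN; exists i => //.
  rewrite sumr_const card_ord -[_^-1 *+ _]mulr_natr /n natrM mulrA mulVf ?mul1r //.
  by rewrite ltNge aM.
(* Only the last holding time has a positive threshold; the zero thresholds contribute factors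
   [expR 0] = 1. *)
pose A (mj : nat * nat) : set W := [set w | forall i, (i <= mj.1)%N ->
  X i w \in B /\ (if i == mj.1 then mj.2%:R else 0) < E i w].
have mA mj : measurable (A mj).
  exact: (measurable_stay law B mj.1 (fun i => if i == mj.1 then mj.2%:R else 0)).
have QA mj : Q (A mj) = (a mj.1 * expR (- mj.2%:R))%:E.
  rewrite /A (@stay_prob _ _ _ _ _ _ _ _ law B mj.1
    (fun i => if i == mj.1 then mj.2%:R else 0)) ?balllist_uniq //; last first.
    by move=> i; case: ifP.
  congr (_ * _)%:E; rewrite big_ord_recr /= eqxx big1 ?mul1r // => i _.
  by rewrite ltn_eqF // oppr0 expR0.
(* The time before the exit is at most the number of [(m, j)] with [j < J] such
   that [A (m, j)] occurs, unless the exit comes after step [N] or some holding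
   time exceeds [J]; these two events get weight [n]. *)
pose J := n.
pose s : seq (nat * (nat * nat)) := (n, (N, 0%N)) ::
  [seq (1%N, (m, j)) | m <- iota 0 n, j <- iota 0 J] ++
  [seq (n, (m, J)) | m <- iota 0 n].
have sE (f : nat * nat -> R) : \sum_(i <- s) i.1%:R * f i.2 =
    n%:R * f (N, 0%N) + (\sum_(m < n) \sum_(j < J) f (val m, val j) +
    \sum_(m < n) n%:R * f (val m, J)).
  have iotaE k (F : nat -> R) : \sum_(m <- iota 0 k) F m = \sum_(m < k) F m.
    by rewrite -(big_mkord xpredT F) /index_iota subn0.
  rewrite big_cons big_cat big_allpairs_dep big_map !iotaE /=.
  congr (_ + (_ + _)); apply: eq_bigr => m _.
  by rewrite iotaE; apply: eq_bigr => j _; rewrite mul1r.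
have [mF QF] := @markov_indic_sum R _ W Q _ s (fun i => i.1%:R) (fun i => A i.2)
  (fun i => a i.2.1 * expR (- i.2.2%:R)) n%:R (fun=> ler0n _ _) (fun=> mA _)
  (fun=> QA _).
set F := [set w | _] in mF QF.
exists F; split => //.
- rewrite (sE (fun mj => a mj.1 * expR (- mj.2%:R))) /= in QF.
  have nR : 0 < n%:R :> R by rewrite ltr0n.
  rewrite -(@lee_pmul2l _ n%:R%:E) //; apply: (le_trans QF).
  rewrite -EFinM lee_fin oppr0 expR0 mulr1.
  have nM : n%:R = 16 * M%:R :> R by rewrite /n natrM.
  have h1 : n%:R * a N <= M%:R.
    by apply: (le_trans (ler_wpM2l (ltW nR) aN)); rewrite nM; lra.
  have h2 : \sum_(m < n) \sum_(j < J) a m * expR (- j%:R) <= M%:R * 2.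
    rewrite (eq_bigr (fun m => a (val m) * \sum_(j < J) expR (- j%:R))); last first.
      by move=> m _; rewrite mulr_sumr.
    rewrite -mulr_suml; apply: ler_pM (aM _) (sum_expRN _ _).
      by apply: sumr_ge0.
    by apply: sumr_ge0 => j _; exact: expR_ge0.
  have h3 : \sum_(m < n) n%:R * (a m * expR (- J%:R)) <= M%:R.
    rewrite -mulr_sumr -mulr_suml mulrCA.
    rewrite -[leRHS]mulr1; apply: ler_pM (aM _) _.
    - by apply: sumr_ge0.
    - by rewrite mulr_ge0 ?expR_ge0 // ltW.
    rewrite expRN ler_pdivrMr ?expR_gt0 // mul1r.
    by apply: le_trans (expR_ge1Dx _); rewrite /J; lra.
  by rewrite nM in h1 h3 *; lra.
move=> w Fw E0.
have : \sum_(i <- s) i.1%:R * \1_(A i.2) w < n%:R :> R by rewrite ltNge; apply/negP.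
rewrite (sE (fun mj => \1_(A mj) w)) => fw.
have I0 mj : 0 <= \1_(A mj) w :> R by rewrite indicE.
have I1 mj : A mj w -> \1_(A mj) w = 1 :> R by move=> h; rewrite indicE mem_set.
have S1 : 0 <= \sum_(m < n) \sum_(j < J) \1_(A (val m, val j)) w :> R.
  by apply: sumr_ge0 => m _; exact: sumr_ge0.
have S2 : 0 <= \sum_(m < n) n%:R * \1_(A (val m, J)) w :> R.
  by apply: sumr_ge0 => m _; rewrite mulr_ge0.
have nN : ~ A (N, 0%N) w.
  move=> AN; move: fw; rewrite (I1 _ AN) mulr1.
  by lra.
have nJ m : (m < n)%N -> ~ A (m, J) w.
  move=> mn Am; suff : n%:R <= \sum_(m < n) n%:R * \1_(A (val m, J)) w :> R.
    by have := mulr_ge0 (ler0n R n) (I0 (N, 0%N)); lra.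
  rewrite (bigD1 (Ordinal mn)) // (I1 (val (Ordinal mn), J) Am) mulr1 lerDl.
  by apply: sumr_ge0 => i _; rewrite mulr_ge0.
have ex : exists i, (i <= N)%N && (X i w \notin B).
  apply: contrapT => nex; apply: nN => i iN; split; last by case: ifP.
  by apply/negPn/negP => XB; apply: nex; exists i; rewrite iN.
case: (ex_minnP ex) => tau /andP[tauN XB] taumin.
have inB i : (i < tau)%N -> X i w \in B.
  move=> it; apply/negPn/negP => XiB; have := taumin i; rewrite XiB andbT; lia.
have jt : jtime R E tau w <= n%:R.
  apply: (@le_trans _ _ 
    (\sum_(m < n) \sum_(j < J) \1_(A (val m, val j)) w)); last first.
    by have := mulr_ge0 (ler0n R n) (I0 (N, 0%N)); lra.
  have tn : (tau <= n)%N by lia.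
  rewrite /jtime (big_ord_widen _ (E ^~ w) tn) big_mkcond /=.
  apply: ler_sum => m _; case: ifP => [mt|_]; last exact: sumr_ge0.
  have inA j : j%:R < E m w -> A (val m, j) w.
    move=> jE i /= im; split; first by apply: inB; lia.
    by case: eqP => [->|].
  have EJ : E m w <= J%:R.
    by rewrite leNgt; apply/negP => /inA; exact: nJ (ltn_ord m).
  apply: (le_trans (le_sum_gt_nat EJ)); apply: ler_sum => j _.
  by case: ltP => // /inA Aj; rewrite indicE mem_set.
exists (jtime R E tau w / n%:R).
have nR : 0 < n%:R :> R by rewrite ltr0n.
split.
  rewrite divr_ge0 ?ler_pdivrMr ?mul1r ?jt ?ler0n //.
  by apply: sumr_ge0 => i _; exact: ltW.
rewrite mulrC divfK ?gt_eqF // Ywalk_jtime //.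
by move: XB; rewrite mem_balllist -leqNgt.
Qed.

End ExitTime.

(** * Non-tightness *)

Lemma not_tight (R : realType) (n0 : nat) (H : set (vtx n0))
    (d : measure_display) (W : measurableType d) (Q : probability W R)
    (X : nat -> W -> vtx n0) (E : nat -> W -> R) :
  infinite_tree H ->
  (forall lam, (0 < lam)%N -> exists r, thin lam r (fun v => `[< H v >])) ->
  walk_law H Q X E -> ~ tight_family Q (Ztilde X E).
Proof.
move=> HT Hthin law /(_ 4^-1) []; first by rewrite invr_gt0.
move=> K [/D_compact_bounded[C0 HC0] HK].
pose C := `|C0|.
(* Thinness gives n <= 16 (n0 + 1) r^3 / lam, so this choice forces C n^(1/3) < r. *)
pose lam := (Num.truncn (16 * n0.+1%:R * C ^+ 3)).+1.
have lamP : 16 * n0.+1%:R * C ^+ 3 < lam%:R by exact: truncnS_gt.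
have [r /andP[r0 thr]] := Hthin lam (ltn0Sn _).
have [] := fast_exit HT law r0; set n := (16 * _)%N => npos [F [mF QF HF]].
have [M [mM sM QM]] := HK n npos.
have [N [mN QN sN]] := holding_gt0 law HT.
(* [M] has probability at least 3/4, whereas [F] together with a null set has at most 1/4. *)
have [w [Mw Fw Ew]] : exists w, [/\ M w, ~ F w & forall i, 0 < E i w].
  apply: contrapT => nw.
  have MFN : M `<=` F `|` N.
    move=> w Mw; apply: contrapT => /not_orP[nF nN]; apply: nw; exists w.
    by split => //; apply: contrapT => nE; apply: nN; exact: sN.
  have : (Q M <= (4^-1)%:E)%E.
    apply: (@le_trans _ _ (Q (F `|` N))).
      by apply: le_measure; rewrite ?inE //; exact: measurableU.
    by apply: (le_trans (measureU2 _ mF mN)); rewrite [X in (_ + X)%E]QN adde0.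
  by move=> /(le_trans QM); rewrite lee_fin; lra.
have [t [t01 rY]] := HF w Fw Ew.
have := HC0 _ (sM _ Mw) _ t01; apply/negP; rewrite -ltNge.
apply: le_lt_trans (ler_norm _) _; rewrite -/C /Ztilde.
set q := n%:R `^ _.
have nR : 0 < n%:R :> R by rewrite ltr0n.
have q0 : 0 < q by rewrite powR_gt0.
have q3 : q ^+ 3 = n%:R.
  by rewrite -powR_mulrn ?ltW // /q -powRrM mulVf ?powRr1 // ltW.
apply: lt_le_trans (ler_norm _); rewrite [ltRHS]mulrC ltr_pdivlMr //.
apply: (@lt_le_trans _ _ r%:R); last by rewrite ler_nat.
have C_ge0 : 0 <= C by exact: normr_ge0.
rewrite -(@ltr_pXn2r _ 3) ?nnegrE ?mulr_ge0 // ?ltW // exprMn q3.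
have c0 : 0 < 16 * n0.+1%:R :> R by rewrite mulr_gt0.
rewrite -(ltr_pM2l c0) mulrA.
apply: (@lt_le_trans _ _ (lam%:R * n%:R)); first by rewrite ltr_pM2r.
have -> : 16 * n0.+1%:R * r%:R ^+ 3 = (16 * n0.+1 * (r * r ^ 2))%:R :> R.
  by rewrite -expnS natrM natrX natrM.
rewrite -natrM ler_nat /n.
set V := ballcard _ r in thr *.
have -> : (lam * (16 * (r * n0.+1 * V)) = 16 * n0.+1 * (r * (lam * V)))%N by ring.
by rewrite !leq_mul2l thr !orbT.
Qed.

Theorem theorem1p5 (R : realType) (n0 : nat) (hn0 : (2 <= n0)%N)
  (d : measure_display) (Omega : measurableType d) (P : probability Omega R)
  (G : Omega -> set (vtx n0)) :
  IIC_law P G ->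
  {ae P, forall w, forall (d' : measure_display) (Omega' : measurableType d')
     (Q : probability Omega' R) (X : nat -> Omega' -> vtx n0) (E : nat -> Omega' -> R),
     walk_law (G w) Q X E -> ~ tight_family Q (Ztilde X E)}.
Proof.
move=> IIC; have HT := IIC_tree hn0 IIC; have Hthin := IIC_thin hn0 IIC.
move: HT Hthin; apply: filterS2 => w HT Hthin d' Omega' Q X E.
exact: not_tight.
Qed.
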